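(* Let $\beta\in\mathbb{R}$ satisfy $4\log 2<\beta<3$ and let $d>0$ be fixed. For each positive integer $N$ that is a multiple of $3$ and for which $M:=dN$ is a positive integer, let $0=\beta_0<\beta_1<\dots<\beta_M=\beta$ be a sequence of inverse temperatures, and let $\mathcal{R}=\mathcal{R}_N$ be the transition matrix on $\Omega^{M+1}$ of Equi-Energy Sampling for the 3-state mean-field Potts model with completely filled memory matrix (state $M_0$). Then $\mathcal{R}_N$ mixes slowly: there exist $c>0$ and $N_0$ such that for all such $N\ge N_0$ the mixing time satisfies $t_{\mathrm{mix}}(N)\ge e^{cN}$.
   Context: Potts model. $\Omega=\{1,2,3\}^N$, $H(\sigma)=H_N(\sigma)=\frac1{2N}\sum_{i,j=1}^N \mathbf 1_{\{\sigma_i=\sigma_j\}}$, and for $b\ge 0$ the Gibbs measure is $\pi_b(\sigma)=e^{bH(\sigma)}/Z_b$ with $Z_b=\sum_{\tau\in\Omega}e^{bH(\tau)}$. The number $\beta_c=4\log 2$ is the critical inverse temperature. For $N$ a multiple of $3$, $\inf H=N/6$ and $\sup H=N/2$. Metropolis chain. $K_{gen}(\sigma,\tau)=\frac12$ if $\sigma=\tau$, $\frac1{4N}$ if $\sigma,\tau$ differ in exactly one coordinate, and $0$ otherwise. For $b\ge0$: $T_b(x,y)=K_{gen}(x,y)$ if $x\ne y$ and $H(y)\ge H(x)$; $T_b(x,y)=K_{gen}(x,y)\frac{\pi_b(y)}{\pi_b(x)}$ if $x\neq y$ and $H(y)<H(x)$; $T_b(x,x)=1-\sum_{z\ne x}T_b(x,z)$.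 Equi-Energy Sampling (EES). Energy levels are equidistant: $h_k=\frac N6+\frac kM\left(\frac N2-\frac N6\right)$, $k=0,\dots,M$, where $M=dN$. In general, the EES keeps a memory matrix $\mathcal M$ recording for each temperature level which states have been seen there, and equi-energy jumps at level $i$ go to states in the same energy band recorded at level $i-1$. The state $M_0$ of the memory is the one in which all states of $\Omega$ have been seen at all temperature levels; the memory then no longer changes, and the chain $\mathcal S$ on (configurations, memory) evolves on its first component $\Omega^{M+1}$ according to the following time-homogeneous transition matrix $\mathcal R$. Put $B_k=\{\tau\in\Omega: h_{k-1}<H(\tau)\le h_k\}$, $k=1,\dots,M$. For $1\le i\le M$ and $\sigma\in B_k$, $\tau\neq\sigma$, $$Q_i(\sigma,\tau)=\frac1{|B_k|}\min\left\{1,\frac{\pi_{\beta_i}(\tau)\pi_{\beta_{i-1}}(\sigma)}{\pi_{\beta_i}(\sigma)\pi_{\beta_{i-1}}(\tau)}\right\}\mathbf 1_{\{\tau\in B_k\}},\qquad Q_i(\sigma,\sigma)=1-\sum_{\tau\ne\sigma}Q_i(\sigma,\tau);$$ if $H(\sigma)=h_0$ (so $\sigma$ is in no band) the step stays put: $Q_i(\sigma,\sigma)=1$. There are no equi-energy moves at level $0$, i.e. $Q_0=I$. Index the coordinates of $\Omega^{M+1}$ by $0,\dots,M$; let $\mathcal Q_i$ (resp. $\mathcal T_i$) be the matrix on $\Omega^{M+1}$ acting as $Q_i$ (resp. $T_{\beta_i}$) on the $i$-th coordinate and as the identity on all other coordinates. Then $$\mathcal R=\frac1{(M+1)^3}\sum_{j,k,l=0}^M\mathcal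 Q_j\mathcal T_k\mathcal Q_l .$$ Mixing time. The target measure is $\tilde\pi(x)=\prod_{i=0}^M\pi_{\beta_i}(x_i)$ on $\Omega^{M+1}$, and $t_{\mathrm{mix}}(N)=\inf\{t\in\mathbb N:\max_{x\in\Omega^{M+1}}\|\mathcal R^t(x,\cdot)-\tilde\pi\|_{TV}\le \tfrac14\}$ (with $\inf\emptyset=\infty$), $\|\cdot\|_{TV}$ being total variation distance. *)

(* Defs.v *)
From mathcomp Require Import all_boot all_order all_algebra.
From mathcomp Require Import all_classical all_reals all_analysis.

Set Implicit Arguments.
Unset Strict Implicit.
Unset Printing Implicit Defensive.

Import Order.TTheory GRing.Theory Num.Theory.

Local Open Scope ring_scope.

(** * Kernels on a finite type

MathComp matrices are indexed by ordinals; a matrix indexed by a finite type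
[T] is represented here by its entries [T -> T -> R]. *)

Section Kernels.
Context {R : realType} {T : finType}.
Implicit Types (K L : T -> T -> R) (mu nu : T -> R).

Definition kid : T -> T -> R := fun x y => (x == y)%:R.

Definition kmul K L : T -> T -> R := fun x y => \sum_z K x z * L z y.

Definition kpow K (t : nat) : T -> T -> R := iter t (kmul K) kid.

Definition dTV mu nu : R :=
  \big[Num.max/0]_(A : {set T}) `|\sum_(x in A) mu x - \sum_(x in A) nu x|.

(* Extended-real valued, so that the infimum of the empty set is +oo. *)
Definition tmix K mu : \bar R :=
  ereal_inf [set (t%:R)%:E | t in
    [set t : nat | \big[Num.max/0]_(x : T) dTV (kpow K t x) mu <= 4^-1]]%classic.

End Kernels.

(** * The three-state mean-field Potts model *)

Definition Omega (N : nat) : finType := {ffun 'I_N -> 'I_3}.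

Section Potts.
Context {R : realType} {N : nat}.
Implicit Types (b : R) (s t x y : Omega N).

Definition H s : R := (2 * N%:R)^-1 * \sum_(i < N) \sum_(j < N) (s i == s j)%:R.

Definition Z b : R := \sum_(t : Omega N) expR (b * H t).

Definition gibbs b s : R := expR (b * H s) / Z b.

Definition Kgen s t : R :=
  if s == t then 2^-1
  else if #|[pred i | s i != t i]| == 1%N then (4 * N%:R)^-1
  else 0.

Definition metropolis_off b x y : R :=
  if H x <= H y then Kgen x y else Kgen x y * (gibbs b y / gibbs b x).

Definition metropolis b x y : R :=
  if x == y then 1 - \sum_(z | z != x) metropolis_off b x z
  else metropolis_off b x y.

End Potts.

(** * Equi-energy sampling with completely filled memory

Throughout, [M] is the number of energy bands and [b 0, ..., b M] are the
inverse temperatures; values of [b] beyond [M] play no role. *)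

Section EES.
Context {R : realType} (N M : nat) (b : nat -> R).

Definition energy_level (k : nat) : R :=
  N%:R / 6 + k%:R / M%:R * (N%:R / 2 - N%:R / 6).

(* Meaningful for 1 <= k <= M. *)
Definition band (k : nat) : {set Omega N} :=
  [set t | energy_level k.-1 < H t <= energy_level k].

(* The bands are pairwise disjoint, so the picked index is the only one; there
   is none exactly when [H s] is the lowest level (for 3 %| N). *)
Definition equi_energy_off (i : nat) (s t : Omega N) : R :=
  if [pick k : 'I_M.+1 | (0 < k)%N && (s \in band k)] is Some k then
    #|band k|%:R^-1
    * Num.min 1 (gibbs (b i) t * gibbs (b i.-1) s
                 / (gibbs (b i) s * gibbs (b i.-1) t))
    * (t \in band k)%:R
  else 0.

Definition equi_energy (i : nat) (s t : Omega N) : R :=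
  if i == 0%N then kid s t
  else if s == t then 1 - \sum_(u | u != s) equi_energy_off i s u
  else equi_energy_off i s t.

Definition EESstate : finType := {ffun 'I_M.+1 -> Omega N}.

Definition on_coord (i : 'I_M.+1) (K : Omega N -> Omega N -> R)
    (x y : EESstate) : R :=
  if [forall j, (j != i) ==> (x j == y j)] then K (x i) (y i) else 0.

Definition Qlift (i : 'I_M.+1) := on_coord i (equi_energy i).

Definition Tlift (i : 'I_M.+1) := on_coord i (metropolis (b i)).

Definition EES (x y : EESstate) : R :=
  ((M.+1%:R) ^+ 3)^-1 *
  \sum_(j < M.+1) \sum_(k < M.+1) \sum_(l < M.+1)
     kmul (kmul (Qlift j) (Tlift k)) (Qlift l) x y.

Definition EEStarget (x : EESstate) : R := \prod_(i < M.+1) gibbs (b i) (x i).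

End EES.

Arguments EES {R} N M b x y.
Arguments EEStarget {R} N M b x.

Definition admissible {R : realType} (d : R) (N M : nat) : Prop :=
  [/\ (0 < N)%N, (3 %| N)%N, (0 < M)%N & M%:R = d * N%:R].

Definition temperature_ladder {R : realType} (beta : R) (M : nat)
    (b : nat -> R) : Prop :=
  [/\ b 0%N = 0, b M = beta & forall i, (i < M)%N -> b i < b i.+1].

(* Main.v *)
(** The coordinate of index [M] (inverse temperature [beta]) evolves autonomously,
by the kernel [A B A] with [A = (1-p) + p Q], [B = (1-p) + p T], [p = 1/(M+1)],
where [T] is Metropolis at [beta] and [Q] is the equi-energy kernel.  It suffices
to trap it at low energy, since [beta > 4 log 2] makes that region
exponentially unlikely under the Gibbs measure.

Put [h = H - N/6] and [D = beta_M - beta_(M-1)].  [T] is reversible for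
[e^(beta H)], whereas [Q] is reversible only for [e^(D H)] inside each band, so the
stationary measure is not explicit.  Work in L2 of the weight [e^(D h)] on
[h <= r^2 N], with [r] a small constant.  There the failure of reversibility of [T]
costs only [O(r^2)] in the quadratic form.  On the other hand one Metropolis step
changes [h] by [O(r)], much less than the constant band width [w], and [h] drifts
downwards because [D <= beta < 3]; so a function that [Q] makes nearly constant on
the bands pays a Dirichlet energy of order [r] for jumping between them, and
[r >> r^2].  Hence the L2 norm of the density of the killed chain grows at most
linearly in time, up to a contribution of very low energies bounded by site
permutation symmetry, and the mass escaping through the top is
exponentially small. *)

Require Import Defs.
From mathcomp Require Import all_boot all_order all_algebra all_fingroup.
From mathcomp Require Import all_classical all_reals all_analysis.
From mathcomp Require Import ring lra zify.

Set Implicit Arguments.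
Unset Strict Implicit.
Unset Printing Implicit Defensive.

Import Order.TTheory GRing.Theory Num.Theory.

Local Open Scope ring_scope.

(** * Dirichlet forms and lazy reversible kernels *)

Section DirichletForms.
Context {R : realType} {T : finType}.
Implicit Types (rho f g : T -> R) (q : T -> T -> R).

(** The ladder is arbitrary, so nothing is known of [D] beyond [0 <= D <= beta]; the final constants
    depend on [beta], [w] and [r] but not on [D], and e^(D w) is replaced by e^(beta w). The
    obstacle is the bottom. The downward drift is proportional to h/N, so it is of order r^2 only
    from a level [h0] of order r^2 N upwards, and the Hardy inequality carries an error term from
    below [h0]. There the density is bounded pointwise: it is invariant under site permutations, and
    the orbit of a state of excess h has at least 3^N e^(-6h) elements up to polynomial factors. The
    level [h0] is chosen so low that the square of this bound, e^(gap/8 * r^2 N), loses against the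
    weight e^(-gap/4 * r^2 N) of the layer from which the chain can escape. Densities evolve under
    the killed adjoint [step], observables under [chain]; duality turns survival of the average mass
    into the existence of a starting state that stays trapped. Terms of order p^2 are harmless since
    p is of order 1/N and r is fixed. *)

Lemma weighted_cauchy_schwarz (rho : R) (a b : T -> R) :
  0 < rho -> (forall i, 0 <= a i) -> \sum_i a i <= rho ->
  (\sum_i a i * b i) ^+ 2 <= rho * \sum_i a i * b i ^+ 2.
Proof.
move=> rho0 a0 arho; set s := \sum_i a i * b i; set s2 := \sum_i _.
have quad_ge0 t : 0 <= s2 - 2 * t * s + t ^+ 2 * rho.
  have : 0 <= \sum_i a i * (b i - t) ^+ 2.
    by apply: sumr_ge0 => i _; rewrite mulr_ge0 ?sqr_ge0.
  have -> : \sum_i a i * (b i - t) ^+ 2 = s2 - 2 * t * s + t ^+ 2 * \sum_i a i.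
    rewrite /s2 /s !mulr_sumr -sumrN -!big_split /=; apply: eq_bigr => i _; ring.
  by move=> /le_trans; apply; rewrite lerD2l ler_wpM2l ?sqr_ge0.
have := quad_ge0 (s / rho).
have -> : s2 - 2 * (s / rho) * s + (s / rho) ^+ 2 * rho = s2 - s ^+ 2 / rho.
  by field; rewrite gt_eqF.
by rewrite subr_ge0 ler_pdivrMr // mulrC.
Qed.

Definition dotw rho f g : R := \sum_x rho x * f x * g x.

Definition norm2 rho f : R := dotw rho f f.

Definition dform q f g : R :=
  2^-1 * \sum_x \sum_y q x y * ((f x - f y) * (g x - g y)).

Lemma norm2_ge0 rho f : (forall x, 0 <= rho x) -> 0 <= norm2 rho f.
Proof.
by move=> r0; apply: sumr_ge0 => x _; rewrite -mulrA mulr_ge0 // -expr2 sqr_ge0.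
Qed.

Lemma dform_ge0 q f : (forall x y, 0 <= q x y) -> 0 <= dform q f f.
Proof.
move=> q0; rewrite mulr_ge0 // sumr_ge0 // => x _; apply: sumr_ge0 => y _.
by rewrite mulr_ge0 // -expr2 sqr_ge0.
Qed.

(** Summation by parts: exchange [x] and [y] in the sum and average with the original. *)
Lemma sum_skew_dform q f g : (forall x y, q x y = q y x) ->
  \sum_x \sum_y q x y * ((f x - f y) * g x) = dform q f g.
Proof.
move=> qC; set s := LHS.
have sE : s = - \sum_x \sum_y q x y * ((f x - f y) * g y).
  rewrite exchange_big /= -sumrN; apply: eq_bigr => x _.
  by rewrite -sumrN; apply: eq_bigr => y _; rewrite qC; ring.
have : s + s = \sum_x \sum_y q x y * ((f x - f y) * (g x - g y)).
  rewrite {2}sE -sumrN -big_split; apply: eq_bigr => x _ /=.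
  by rewrite -sumrN -big_split; apply: eq_bigr => y _ /=; ring.
by rewrite /dform => <-; field.
Qed.

Lemma dform_le_norm2 rho q f : (forall x y, 0 <= q x y) ->
    (forall x y, q x y = q y x) -> (forall x, \sum_y q x y <= rho x) ->
  dform q f f <= 2 * norm2 rho f.
Proof.
move=> q0 qC qrho.
have qf : \sum_x \sum_y q x y * f x ^+ 2 <= norm2 rho f.
  apply: ler_sum => x _; rewrite -mulr_suml -mulrA -expr2.
  by rewrite ler_wpM2r ?sqr_ge0.
have qf' : \sum_x \sum_y q x y * f y ^+ 2 <= norm2 rho f.
  rewrite exchange_big /=; apply: le_trans qf; apply: ler_sum => x _.
  by apply: ler_sum => y _; rewrite qC.
rewrite /dform.
have : \sum_x \sum_y q x y * ((f x - f y) * (f x - f y)) <=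
    2 * (\sum_x \sum_y q x y * f x ^+ 2 + \sum_x \sum_y q x y * f y ^+ 2).
  rewrite -big_split mulr_sumr; apply: ler_sum => x _ /=.
  rewrite -big_split mulr_sumr; apply: ler_sum => y _ /=.
  have := mulr_ge0 (q0 x y) (sqr_ge0 (f x + f y)); lra.
lra.
Qed.

(** Minus the generator of the walk with conductances [q], reversible for [rho]. Rows of [q] may sum
    to less than [rho]; the deficit is holding probability. *)
Definition gen rho q f : T -> R :=
  fun x => (rho x)^-1 * \sum_y q x y * (f x - f y).

Definition lazy rho q (p : R) f : T -> R := fun x => f x - p * gen rho q f x.

Section Lazy.
Variables (rho : T -> R) (q : T -> T -> R) (p : R).
Hypotheses (rho_gt0 : forall x, 0 < rho x) (q0 : forall x y, 0 <= q x y).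
Hypotheses (qC : forall x y, q x y = q y x).
Hypotheses (qrho : forall x, \sum_y q x y <= rho x) (p01 : 0 <= p <= 1).

Lemma dotw_gen f g : dotw rho (gen rho q f) g = dform q f g.
Proof.
rewrite -sum_skew_dform //; apply: eq_bigr => x _.
rewrite /gen mulrA mulfV ?gt_eqF // mul1r mulr_suml.
by apply: eq_bigr => y _; ring.
Qed.

(** Cauchy-Schwarz in each row, with weights [q x y] of total at most [rho x]. In operator terms,
    the square of [gen] is at most twice [gen]. *)
Lemma norm2_gen f : norm2 rho (gen rho q f) <= 2 * dform q f f.
Proof.
rewrite /dform mulrA mulfV // mul1r; apply: ler_sum => x _.
rewrite /gen -mulrA -expr2 exprMn.
have := weighted_cauchy_schwarz (fun y => f x - f y) (rho_gt0 x) (q0 x) (qrho x).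
rewrite -ler_pdivrMl ?rho_gt0 // => /le_trans h.
have -> : rho x * ((rho x)^-1 ^+ 2 * (\sum_y q x y * (f x - f y)) ^+ 2) =
    (rho x)^-1 * (\sum_y q x y * (f x - f y)) ^+ 2.
  by field; rewrite gt_eqF.
by apply: h; apply: ler_sum => y _; rewrite expr2.
Qed.

Lemma norm2_lazy f :
  norm2 rho (lazy rho q p f) <= norm2 rho f - 2 * p * (1 - p) * dform q f f.
Proof.
have -> : norm2 rho (lazy rho q p f) = norm2 rho f
    - 2 * p * dotw rho (gen rho q f) f + p ^+ 2 * norm2 rho (gen rho q f).
  rewrite /norm2 /dotw !mulr_sumr -sumrN -!big_split /=.
  by apply: eq_bigr => x _; rewrite /lazy; ring.
rewrite dotw_gen; have := norm2_gen f; have := sqr_ge0 p => p2 h.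
have := ler_wpM2l p2 h; lra.
Qed.

(** With u = [gen rho q f], the correction is -2p |u|^2 + p^2 dform(u,u), and dform(u,u) <= 2 |u|^2
    makes it nonpositive for p in [0,1]. This lets the dissipation of a lazy step be charged to its
    output instead of its input. *)
Lemma dform_lazy f : dform q (lazy rho q p f) (lazy rho q p f) <= dform q f f.
Proof.
set u := gen rho q f.
have -> : dform q (lazy rho q p f) (lazy rho q p f) =
    dform q f f - 2 * p * dform q f u + p ^+ 2 * dform q u u.
  rewrite /dform !mulr_sumr -sumrN -!big_split /=; apply: eq_bigr => x _.
  rewrite !mulr_sumr -sumrN -!big_split /=; apply: eq_bigr => y _.
  rewrite /lazy -/u; ring.
rewrite -(dotw_gen f u) -/u -/(norm2 rho u).
have h := dform_le_norm2 (rho := rho) u q0 qC qrho.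
have n0 := norm2_ge0 u (fun x => ltW (rho_gt0 x)).
have := ler_wpM2l (sqr_ge0 p) h.
case/andP: p01 => p0 p1; have : 0 <= p * (1 - p) * norm2 rho u.
  by rewrite !mulr_ge0 // subr_ge0.
nra.
Qed.

End Lazy.

End DirichletForms.

(** * Dissipation through energy bands *)

Section Bands.
Context {R : realType} {T : finType}.
Variables (h : T -> R) (K : T -> T -> R) (j : T -> nat) (J : nat).
Variables (D w r c : R).
Hypotheses (h_ge0 : forall x, 0 <= h x) (w_gt0 : 0 < w) (r_gt0 : 0 < r).
Hypotheses (K_ge0 : forall x y, 0 <= K x y) (K_sym : forall x y, K x y = K y x).
Hypothesis K_le1 : forall x, \sum_y K x y <= 1.
Hypothesis jP : forall x, (j x)%:R * w - w < h x <= (j x)%:R * w.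

Definition weight x : R := expR (D * h x).

(** Conductances of the Metropolis chain with proposal [K] at inverse temperature [D], the one
    reversible for [weight]; the actual chain, run at [beta], is compared with it later. *)
Definition cond x y : R := K x y * Num.min (weight x) (weight y).

Lemma wt_gt0 x : 0 < weight x. Proof. exact: expR_gt0. Qed.

Lemma cond_ge0 x y : 0 <= cond x y.
Proof. by rewrite mulr_ge0 // le_min !ltW ?wt_gt0. Qed.

Lemma cond_sym x y : cond x y = cond y x.
Proof. by rewrite /cond K_sym minC. Qed.

Lemma sum_cond x : \sum_y cond x y <= weight x.
Proof.
apply: (@le_trans _ _ (\sum_y K x y * weight x)).
  by apply: ler_sum => y _; rewrite ler_wpM2l // ge_min lexx.
by rewrite -mulr_suml ler_piMl // ltW ?wt_gt0.
Qed.

Lemma lt_j_lt_h x y : (j y < j x)%N -> h y < h x.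
Proof.
move=> jyx; have /andP[hx _] := jP x; have /andP[_ hy] := jP y.
apply: le_lt_trans hx; apply: (le_trans hy).
have : (j y).+1%:R <= (j x)%:R :> R by rewrite ler_nat.
rewrite -natr1 => jj; have /= := ler_wpM2r (ltW w_gt0) jj; lra.
Qed.

Lemma h_eq0 x : j x = 0%N -> h x = 0.
Proof.
move=> j0; have := h_ge0 x; have /andP[_] := jP x; rewrite j0 mul0r.
by move=> ? ?; apply/le_anti/andP.
Qed.

Hypothesis edge_le : forall x y, (j x <= J)%N -> K x y != 0 -> `|h x - h y| <= 4 * r.
Hypothesis r_small : 4 * r <= w / 2.

Lemma cond_edge x y : (j x <= J)%N -> cond x y != 0 -> `|h x - h y| <= 4 * r.
Proof. by move=> jx; rewrite mulf_eq0 negb_or => /andP[/edge_le-/(_ jx)]. Qed.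

Lemma cond_edgeC x y : (j y <= J)%N -> cond x y != 0 -> `|h x - h y| <= 4 * r.
Proof. by move=> jy; rewrite cond_sym distrC; apply: cond_edge. Qed.

(** [weight x] times the mean decrease of [h] under the Metropolis chain at inverse temperature [D];
    positive values mean downward drift. *)
Definition drift x : R := \sum_y cond x y * (h x - h y).

Hypothesis drift_ub : forall x, (j x <= J)%N -> drift x <= 2 * r ^+ 2 * weight x.

Let pos x : R := ((j x)%:R * w - h x) / w.

Lemma pos_ge0 x : 0 <= pos x.
Proof. by rewrite divr_ge0 ?(ltW w_gt0) // subr_ge0; have /andP[] := jP x. Qed.

Lemma pos_le1 x : pos x <= 1.
Proof. by rewrite ler_pdivrMr // mul1r; have /andP[] := jP x; lra. Qed.

(* Testing the generator against the position inside the band, which drops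
   from 1 to 0 across a band, compares the flux through the bottom of the band
   with the drift and the energy dissipated inside the band. *)
Lemma layer_flux (d : T -> R) : (forall x, 0 <= d x) ->
    (forall x y, j x = j y -> d x = d y) -> (forall x, (J < j x)%N -> d x = 0) ->
  \sum_x \sum_y cond x y * (d x * ((j y < j x)%N%:R * (h x - h y)))
    <= (4 + 48 / w) * r ^+ 2 * \sum_x weight x * d x.
Proof.
move=> d_ge0 d_band dJ.
(* Conductances inside the bands, weighted by [d]; symmetric because [d] is constant on each
   band. *)
pose q x y := cond x y * (d x * (j x == j y)%:R).
have qC x y : q x y = q y x.
  rewrite /q cond_sym (eq_sym (j x)); have [jyx|_] := eqVneq (j y) (j x).
    by rewrite (d_band _ _ jyx).
  by rewrite !mulr0.
have r2w : 0 <= 16 * r ^+ 2 / w 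
  by rewrite divr_ge0 ?(ltW w_gt0) // mulr_ge0 // sqr_ge0.
have sumd : \sum_x \sum_y cond x y * d x <= \sum_x weight x * d x.
  by apply: ler_sum => x _; rewrite -mulr_suml ler_wpM2r ?sum_cond.
have sqr_edge x y : (j x <= J)%N -> cond x y != 0 -> (h x - h y) ^+ 2 <= 16 * r ^+ 2.
  move=> jx /(cond_edge jx) e; rewrite -real_normK ?num_real //.
  have := normr_ge0 (h x - h y); nra.
(* Inside a band [pos] has slope -1/w as a function of [h], so after symmetrization each edge
   contributes minus a square of size at most 16 r^2 / w. *)
have qpos : - (8 * r ^+ 2 / w * \sum_x weight x * d x) <=
    \sum_x \sum_y q x y * ((h x - h y) * pos x).
  rewrite sum_skew_dform // /dform.
  have : \sum_x \sum_y q x y * ((h x - h y) * (pos x - pos y)) >=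
      - (16 * r ^+ 2 / w * \sum_x \sum_y cond x y * d x).
    rewrite mulr_sumr -sumrN; apply: ler_sum => x _.
    rewrite mulr_sumr -sumrN; apply: ler_sum => y _.
    rewrite /q; case: eqP => [jxy|_]; last first.
      by rewrite !mulr0 mul0r oppr_le0 mulr_ge0 // mulr_ge0 // cond_ge0.
    have [c0|c0] := eqVneq (cond x y) 0; first by rewrite c0 !mul0r mulr0 oppr0.
    have [jx|jx] := leqP (j x) J; last by rewrite dJ // !(mulr0, mul0r) oppr0.
    have -> : pos x - pos y = - (h x - h y) / w by rewrite /pos jxy; ring.
    rewrite mulr1; have -> : cond x y * d x * ((h x - h y) * (- (h x - h y) / w)) =
       - ((h x - h y) ^+ 2 * (cond x y * d x / w)) by ring.
    have -> : 16 * r ^+ 2 / w * (cond x y * d x) = 16 * r ^+ 2 * (cond x y * d x / w).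
      by ring.
    rewrite lerN2 ler_wpM2r ?sqr_edge // divr_ge0 ?(ltW w_gt0) //.
    by rewrite mulr_ge0 // cond_ge0.
  have := ler_wpM2l r2w sumd; lra.
(* Edge by edge: a downward crossing starts within 4r <= w/2 of the bottom of its band, where [pos]
   is at least 1/2; an upward crossing starts within 4r of the top, where [pos] is at most 4r/w;
   edges inside a band match the [q] term exactly. *)
have main : \sum_x \sum_y (2^-1 * (cond x y * (d x * ((j y < j x)%N%:R * (h x - h y))))
     - 16 * r ^+ 2 / w * (cond x y * d x) + q x y * ((h x - h y) * pos x)) <=
    \sum_x \sum_y cond x y * (d x * (pos x * (h x - h y))).
  apply: ler_sum => x _; apply: ler_sum => y _; rewrite /q.
  have [c0|c0] := eqVneq (cond x y) 0; first by rewrite c0 !(mul0r, mulr0); lra.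
  have [jx|jx] := leqP (j x) J; last by rewrite dJ // !(mulr0, mul0r); lra.
  have cd : 0 <= cond x y * d x by rewrite mulr_ge0 ?cond_ge0.
  have := cond_edge jx c0; rewrite ler_norml => /andP[e1 e2].
  have /andP[hx1 hx2] := jP x; have /andP[hy1 hy2] := jP y.
  have posw : pos x * w = (j x)%:R * w - h x by rewrite /pos divfK ?gt_eqF.
  have p0 := pos_ge0 x; have p1 := pos_le1 x.
  have [jyx|jxy|jxy] := ltngtP (j y) (j x).
  - rewrite /= ?mulr0n ?mulr1n.
    have : (j y).+1%:R <= (j x)%:R :> R by rewrite ler_nat.
    rewrite -natr1 => jj; have /= jjw := ler_wpM2r (ltW w_gt0) jj.
    have hyx : 0 <= h x - h y by rewrite subr_ge0 ltW // lt_j_lt_h.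
    have pos2 : 2^-1 <= pos x by rewrite -(ler_pM2r w_gt0) posw; have := r_small; lra.
    have t1 : 0 <= cond x y * d x * (h x - h y) * (pos x - 2^-1).
      by apply: mulr_ge0; [apply: mulr_ge0|rewrite subr_ge0].
    have t2 := mulr_ge0 r2w cd; lra.
  - rewrite /= ?mulr0n ?mulr1n.
    have : (j x).+1%:R <= (j y)%:R :> R by rewrite ler_nat.
    rewrite -natr1 => jj; have /= jjw := ler_wpM2r (ltW w_gt0) jj.
    have pos4 : pos x <= 4 * r / w by rewrite ler_pdivlMr // posw; lra.
    have t1 : pos x * (h y - h x) <= 16 * r ^+ 2 / w.
      have -> : 16 * r ^+ 2 / w = 4 * r / w * (4 * r) by ring.
      by apply: ler_pM => //; lra.
    have := ler_wpM2l cd t1; lra.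
  - rewrite /= ?mulr0n ?mulr1n; have := mulr_ge0 r2w cd; lra.
have drift_le : \sum_x \sum_y cond x y * (d x * (pos x * (h x - h y))) <=
    2 * r ^+ 2 * \sum_x weight x * d x.
  rewrite mulr_sumr; apply: ler_sum => x _.
  have [jx|jx] := leqP (j x) J; last first.
    by rewrite dJ // big1 ?mulr0 // => y _; rewrite mul0r mulr0.
  have -> : \sum_y cond x y * (d x * (pos x * (h x - h y))) = d x * (pos x * drift x).
    by rewrite /drift !mulr_sumr; apply: eq_bigr => y _; ring.
  have -> : 2 * r ^+ 2 * (weight x * d x) = d x * (2 * r ^+ 2 * weight x) by ring.
  apply: ler_wpM2l => //.
  have := drift_ub jx; have := pos_ge0 x; have := pos_le1 x.
  have : 0 <= 2 * r ^+ 2 * weight x by rewrite !mulr_ge0 ?sqr_ge0 // ltW ?wt_gt0.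
  nra.
move: main; under eq_bigr do rewrite !big_split /= sumrN -!mulr_sumr.
rewrite !big_split /= sumrN -!mulr_sumr => main.
(* Half the flux is at most 2 r^2 (drift) plus 16 r^2 / w (upward crossings) plus 8 r^2 / w (edges
   inside bands); doubling gives 4 + 48/w. *)
have := ler_wpM2l r2w sumd; lra.
Qed.

Variable h0 : R.
Hypotheses (c_gt0 : 0 < c).
Hypothesis drift_lb : forall x, (j x <= J)%N -> - (r ^+ 2 * weight x) <= drift x.
Hypothesis drift_lb_far : forall x, (j x <= J)%N -> h0 <= h x ->
  c * r ^+ 2 * weight x <= drift x.

Definition near_bottom (f : T -> R) : R := \sum_(x | h x < h0) weight x * f x ^+ 2.

Let cJ : R := 4 + 48 / w.
(** Young parameter: [s * cJ = c / 2], so the flux term absorbs only half of the gain from the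
    drift. *)
Let s : R := c / (2 * cJ).

Definition hardy_const : R := s * c / 8.
Definition hardy_bottom_const : R := s * (c + 1) / 4.

Lemma cJ_gt0 : 0 < cJ.
Proof. by rewrite ltr_wpDr // divr_ge0 // ltW. Qed.

Lemma s_gt0 : 0 < s.
Proof. by rewrite divr_gt0 // mulr_gt0 // cJ_gt0. Qed.

(* Testing the drift of h against u^2, only pairs of states in different bands
   contribute; Young's inequality and [layer_flux] absorb the terms in u^2. *)
Lemma band_hardy (u : T -> R) : (forall x y, j x = j y -> (0 < j x)%N -> u x = u y) ->
    (forall x, (J < j x)%N -> u x = 0) ->
  hardy_const * r * norm2 weight u <=
    dform cond u u + hardy_bottom_const * r * near_bottom u.
Proof.
move=> u_band uJ; have s0 := s_gt0; have cJ0 := cJ_gt0; have r0 := r_gt0.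
have lower : c * r ^+ 2 * norm2 weight u - (c + 1) * r ^+ 2 * near_bottom u <=
    \sum_x \sum_y cond x y * ((h x - h y) * u x ^+ 2).
  rewrite /near_bottom big_mkcond /norm2 /dotw !mulr_sumr -sumrN -big_split /=.
  apply: ler_sum => x _.
  have -> : \sum_y cond x y * ((h x - h y) * u x ^+ 2) = u x ^+ 2 * drift x.
    by rewrite /drift mulr_sumr; apply: eq_bigr => y _; ring.
  have [jx|jx] := leqP (j x) J; last first.
    by rewrite uJ // expr0n !mulr0 mul0r; case: ifP; rewrite !(mulr0, subr0).
  have wu : 0 <= r ^+ 2 * (weight x * u x ^+ 2).
    by rewrite mulr_ge0 ?sqr_ge0 // mulr_ge0 ?sqr_ge0 // ltW ?wt_gt0.
  have [hx|hx] := ltP (h x) h0.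
    have := ler_wpM2l (sqr_ge0 (u x)) (drift_lb jx); lra.
  have := ler_wpM2l (sqr_ge0 (u x)) (drift_lb_far jx hx); lra.
pose up x y := cond x y * ((j y < j x)%N%:R * (h x - h y) * u x ^+ 2).
(* As jumps of [h] are at most 4r, the gradient term of Young's inequality costs 4r/s times the
   Dirichlet form. Against a gain of order r^2 this leaves a Dirichlet energy of order r. *)
have upper : \sum_x \sum_y cond x y * ((h x - h y) * u x ^+ 2) <=
    s * \sum_x \sum_y up x y + 4 * r / s * dform cond u u.
  rewrite (sum_skew_dform _ _ cond_sym).
  have -> : s * (\sum_x \sum_y up x y) =
      2^-1 * s * \sum_x \sum_y (up x y + up y x).
    under [X in _ = _ * X]eq_bigr do rewrite big_split /=.
    by rewrite big_split /= [X in _ = _ * (_ + X)]exchange_big /=; field.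
  rewrite /dform -[X in _ <= X + _]mulrA [4 * r / s * _]mulrCA -mulrDr ler_wpM2l //.
  rewrite !mulr_sumr -big_split; apply: ler_sum => x _ /=.
  rewrite !mulr_sumr -big_split; apply: ler_sum => y _ /=; rewrite /up (cond_sym y).
  have [c0|c0] := eqVneq (cond x y) 0; first by rewrite c0 !(mul0r, mulr0, addr0).
  have cxy := cond_ge0 x y.
  have rs : 0 <= 4 * r / s by rewrite divr_ge0 ?(ltW s0) // mulr_ge0 // ltW.
  have young a b z : 0 <= z -> (a != 0) || (b != 0) -> z <= 4 * r ->
      z * (a ^+ 2 - b ^+ 2) <= s * (z * a ^+ 2) + 4 * r / s * ((a - b) * (a - b)).
    move=> z0 _ z4.
    have h1 : a ^+ 2 - b ^+ 2 <= s * a ^+ 2 + s^-1 * (a - b) ^+ 2.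
      have -> : s * a ^+ 2 + s^-1 * (a - b) ^+ 2 = a ^+ 2 - b ^+ 2 +
          ((a - b) ^+ 2 + s^-1 * (s * a - (a - b)) ^+ 2).
        by field; rewrite gt_eqF.
      by rewrite lerDl addr_ge0 ?sqr_ge0 // mulr_ge0 ?sqr_ge0 // invr_ge0 ltW.
    have h2 := ler_wpM2l z0 h1.
    have h3 : 0 <= (4 * r - z) * (s^-1 * (a - b) ^+ 2).
      by rewrite mulr_ge0 ?subr_ge0 // mulr_ge0 ?sqr_ge0 // invr_ge0 ltW.
    lra.
  have [u0|u0] := boolP ((u x == 0) && (u y == 0)).
    by case/andP: u0 => /eqP -> /eqP ->; rewrite expr0n !(subrr, mulr0, mul0r, addr0).
  have hxy : `|h x - h y| <= 4 * r.
    move: u0; rewrite negb_and => /orP[] u0.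
      by apply: cond_edge => //; rewrite leqNgt; apply: contraNN u0 => /uJ ->.
    by apply: cond_edgeC => //; rewrite leqNgt; apply: contraNN u0 => /uJ ->.
  move: u0; rewrite negb_and => u0; move: hxy; rewrite ler_norml => /andP[e1 e2].
  have [jyx|jxy|jxy] := ltngtP (j y) (j x).
  - have hyx := lt_j_lt_h jyx; rewrite /= ?mulr1n ?mulr0n.
    have z0 : 0 <= h x - h y by lra.
    have := ler_wpM2l cxy (young _ _ _ z0 u0 e2); lra.
  - have hyx := lt_j_lt_h jxy; rewrite /= ?mulr1n ?mulr0n.
    have z0 : 0 <= h y - h x by lra.
    have z4 : h y - h x <= 4 * r by lra.
    rewrite orbC in u0; have := ler_wpM2l cxy (young _ _ _ z0 u0 z4); lra.
  (* Edges inside a band drop out: [u] is constant on a band of positive index, and on band 0 [h]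
     vanishes identically. *)
  - have -> : (h x - h y) * (u x ^+ 2 - u y ^+ 2) = 0.
      have [j0|j0] := posnP (j x); last by rewrite (u_band x y) ?subrr ?mulr0.
      by rewrite h_eq0 // h_eq0 ?subrr ?mul0r // jxy.
    rewrite /= ?mulr0n !(mul0r, mulr0, addr0, add0r).
    by rewrite mulr_ge0 // mulr_ge0 // -expr2 sqr_ge0.
have flux : \sum_x \sum_y up x y <= cJ * r ^+ 2 * norm2 weight u.
  (* [u] need not be constant on band 0; setting [d] to 0 there loses nothing, since no crossing
     goes down from band 0. *)
  pose d x := if (0 < j x)%N then u x ^+ 2 else 0.
  apply: (@le_trans _ _ (cJ * r ^+ 2 * \sum_x weight x * d x)).
    apply: le_trans (layer_flux (d := d) _ _ _).
    - apply: ler_sum => x _; apply: ler_sum => y _; rewrite /up /d.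
      have [jx|] := ltnP 0 (j x); first by rewrite le_eqVlt; apply/orP; left; apply/eqP; ring.
      by rewrite leqn0 => /eqP ->; rewrite ltn0 !mul0r !mulr0.
    - by move=> x; rewrite /d; case: ifP; rewrite ?sqr_ge0.
    - by move=> x y jxy; rewrite /d -jxy; case: ifP => // /(u_band _ _ jxy)->.
    - by move=> x jx; rewrite /d uJ // expr0n; case: ifP.
  apply: ler_wpM2l; first by rewrite mulr_ge0 ?sqr_ge0 // ltW.
  apply: ler_sum => x _; rewrite -mulrA ler_wpM2l ?(ltW (wt_gt0 x)) // /d -expr2.
  by case: ifP; rewrite ?sqr_ge0.
have sE : s * (cJ * r ^+ 2 * norm2 weight u) = c / 2 * r ^+ 2 * norm2 weight u.
  by rewrite /s; field; rewrite gt_eqF.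
have := ler_wpM2l (ltW s0) flux; rewrite sE => flux'.
have : 0 <= s / (4 * r) * (4 * r / s * dform cond u u + (c + 1) * r ^+ 2 * near_bottom u -
    c / 2 * r ^+ 2 * norm2 weight u).
  apply: mulr_ge0; last by lra.
  by rewrite divr_ge0 ?(ltW s0) // mulr_ge0 // ltW.
set l := (X in 0 <= X) => l0; rewrite -subr_ge0 [leRHS](_ : _ = l) //.
by rewrite /l /hardy_const /hardy_bottom_const; field; rewrite !gt_eqF.
Qed.

End Bands.

Section BandAverage.
Context {R : realType} {T : finType}.
Variables (h : T -> R) (j : T -> nat) (D w : R).
Hypothesis jP : forall x, (j x)%:R * w - w < h x <= (j x)%:R * w.
Hypotheses (D_ge0 : 0 <= D) (w_ge0 : 0 <= w).

Notation wt := (weight h D).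

Definition band_size x : R := #|[pred y | j y == j x]|%:R.

(** Index 0 stands for the states in no energy band, where the equi-energy move stays put; there the
    function is left alone. *)
Definition band_avg (f : T -> R) x : R :=
  if j x == 0%N then f x else (band_size x)^-1 * \sum_(y | j y == j x) f y.

(** Conductances of the equi-energy kernel: uniform proposal in the band with Metropolis acceptance
    for [wt]. *)
Definition band_cond x y : R :=
  if (j x == j y) && (0 < j x)%N then Num.min (wt x) (wt y) / band_size x else 0.

Lemma band_size_gt0 x : 0 < band_size x.
Proof. by rewrite ltr0n; apply/card_gt0P; exists x; rewrite inE. Qed.

Lemma band_sizeE x y : j x = j y -> band_size x = band_size y.
Proof. by rewrite /band_size => ->. Qed.

Lemma sum_band (a : R) x : \sum_(y | j y == j x) a = band_size x * a.
Proof. by rewrite sumr_const mulr_natl. Qed.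

Lemma band_cond_ge0 x y : 0 <= band_cond x y.
Proof.
rewrite /band_cond; case: ifP => // _.
by rewrite divr_ge0 ?(ltW (band_size_gt0 x)) // le_min !ltW ?wt_gt0.
Qed.

Lemma band_cond_sym x y : band_cond x y = band_cond y x.
Proof.
rewrite /band_cond (eq_sym (j x)); have [jxy|] //= := eqVneq (j y) (j x).
by rewrite minC jxy (band_sizeE jxy).
Qed.

Lemma sum_band_cond x : \sum_y band_cond x y <= wt x.
Proof.
apply: (@le_trans _ _ (\sum_(y | j y == j x) wt x / band_size x)).
  rewrite [leRHS]big_mkcond; apply: ler_sum => y _; rewrite /band_cond eq_sym.
  case: eqP => //= _; case: ifP => _.
    by rewrite ler_pM2r ?invr_gt0 ?band_size_gt0 // ge_min lexx.
  by rewrite divr_ge0 ?ltW ?wt_gt0 ?band_size_gt0.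
by rewrite sum_band mulrC divfK ?gt_eqF ?band_size_gt0.
Qed.

Lemma band_avg_band f x y : j x = j y -> (0 < j x)%N -> band_avg f x = band_avg f y.
Proof.
move=> jxy; rewrite /band_avg (band_sizeE jxy) jxy lt0n => /negPf ->.
by [].
Qed.

Lemma wt_band_le x y : j x = j y -> wt x <= expR (D * w) * wt y.
Proof.
move=> jxy; rewrite -expRD ler_expR -mulrDr ler_wpM2l //.
have /andP[_] := jP x; have /andP[+ _] := jP y; rewrite jxy; lra.
Qed.

Lemma sum_mulrb (P : pred T) (F : T -> R) :
  \sum_y (P y)%:R * F y = \sum_(y | P y) F y.
Proof.
rewrite [RHS]big_mkcond; apply: eq_bigr => y _.
by case: (P y); rewrite ?mul1r ?mul0r.
Qed.

(** Jensen for the uniform average bounds the fluctuation by squared differences within the band;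
    [wt] varies there by a factor of at most e^(D w), which allows passing from [wt x] to the
    smaller of the two weights. *)
Lemma band_variance f :
  norm2 wt (fun x => f x - band_avg f x) <= 2 * expR (D * w) * dform band_cond f f.
Proof.
have -> : 2 * expR (D * w) * dform band_cond f f =
    \sum_x expR (D * w) * \sum_y band_cond x y * ((f x - f y) * (f x - f y)).
  by rewrite -mulr_sumr /dform; field.
apply: ler_sum => x _.
have [j0|j0] := posnP (j x).
  rewrite {1}/band_avg j0 eqxx subrr mulr0 mul0r mulr_ge0 ?expR_ge0 // sumr_ge0 // => y _.
  by rewrite mulr_ge0 ?band_cond_ge0 // -expr2 sqr_ge0.
have n0 := band_size_gt0 x.
pose a y : R := (j y == j x)%:R / band_size x.
have a_ge0 y : 0 <= a y by rewrite divr_ge0 // ltW.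
have aE F : \sum_y a y * F y = (band_size x)^-1 * \sum_(y | j y == j x) F y.
  rewrite mulr_sumr -[RHS]sum_mulrb; apply: eq_bigr => y _; rewrite /a; ring.
have a_sum : \sum_y a y <= 1.
  under eq_bigr do rewrite -[a _]mulr1.
  by rewrite aE sum_band mulrA mulVf ?gt_eqF // mulr1.
have avgE : f x - band_avg f x = \sum_y a y * (f x - f y).
  rewrite aE /band_avg gtn_eqF // big_split /= sum_band sumrN mulrDr mulrA.
  by rewrite mulVf ?gt_eqF // mul1r mulrN.
have := weighted_cauchy_schwarz (fun y => f x - f y) ltr01 a_ge0 a_sum.
rewrite mul1r -avgE => /(ler_wpM2l (ltW (wt_gt0 h D x))).
rewrite -mulrA -expr2 => /le_trans; apply; rewrite !mulr_sumr.
apply: ler_sum => y _; rewrite /a /band_cond eq_sym.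
case: eqP => [jxy|]; last by rewrite !(mul0r, mulr0).
have key : wt x <= expR (D * w) * Num.min (wt x) (wt y).
  rewrite minEle; case: ifP => _; last exact: wt_band_le.
  by rewrite ler_peMl ?(ltW (wt_gt0 _ _ _)) // -expR0 ler_expR mulr_ge0.
have d0 : 0 <= (f x - f y) ^+ 2 / band_size x by rewrite divr_ge0 ?sqr_ge0 // ltW.
by have := ler_wpM2r d0 key; rewrite j0 /= ?mulr1n; lra.
Qed.

End BandAverage.

(** * Dissipation and survival of the killed chain, for an abstract kernel [M] nearly reversible for
    [wt] *)

Section OneStep.
Context {R : realType} {T : finType}.
Variables (h : T -> R) (K : T -> T -> R) (j : T -> nat) (J : nat).
Variables (D w r c h0 E A : R) (M : T -> T -> R).
Implicit Types (f g F : T -> R).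
Hypotheses (h_ge0 : forall x, 0 <= h x) (w_gt0 : 0 < w) (r_gt0 : 0 < r).
Hypotheses (K_ge0 : forall x y, 0 <= K x y) (K_sym : forall x y, K x y = K y x).
Hypothesis K_le1 : forall x, \sum_y K x y <= 1.
Hypothesis jP : forall x, (j x)%:R * w - w < h x <= (j x)%:R * w.
Hypotheses (D_ge0 : 0 <= D) (c_gt0 : 0 < c).
Hypothesis edge_le : forall x y, (j x <= J)%N -> K x y != 0 -> `|h x - h y| <= 4 * r.
Hypothesis r_small : 4 * r <= w / 2.
Notation wt := (weight h D).
Notation cond := (cond h K D).
Notation drift := (drift h K D).
Notation bcond := (band_cond h j D).
Hypothesis drift_ub : forall x, (j x <= J)%N -> drift x <= 2 * r ^+ 2 * wt x.
Hypothesis drift_lb : forall x, (j x <= J)%N -> - (r ^+ 2 * wt x) <= drift x.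
Hypothesis drift_lb_far : forall x, (j x <= J)%N -> h0 <= h x ->
  c * r ^+ 2 * wt x <= drift x.
Hypothesis A_ge0 : 0 <= A.
Hypothesis E_ge : expR (D * w) <= E.
Hypothesis M_ge0 : forall x y, 0 <= M x y.
Hypothesis M_sum : forall x, \sum_y M x y = 1.
Hypothesis M_cond : forall x y, (j x <= J)%N || (j y <= J)%N -> x != y ->
  cond x y <= 2 * (wt x * M x y).
Hypothesis wtM : forall y, (j y <= J)%N ->
  \sum_x wt x * M x y <= (1 + A * r ^+ 2) * wt y.

(* The adjoint of M in L2(wt); M need not be reversible with respect to wt. *)
Definition push (g : T -> R) y : R := (wt y)^-1 * \sum_x wt x * g x * M x y.

Definition energy (g : T -> R) : R := norm2 wt g - dotw wt (push g) g.

Lemma wt_push g y : wt y * push g y = \sum_x wt x * g x * M x y.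
Proof. by rewrite mulrA mulfV ?mul1r // gt_eqF // wt_gt0. Qed.

(** Expand the squares: the rows of [wt x * M x y] sum to [wt x], the columns inside the trap to at
    most (1 + A r^2) [wt y], and this excess is the whole price of non-reversibility. The factor 2
    in [M_cond] cancels the 1/2 in [dform]. *)
Lemma energy_ge g : (forall x, (J < j x)%N -> g x = 0) ->
  2^-1 * dform cond g g - A * r ^+ 2 / 2 * norm2 wt g <= energy g.
Proof.
move=> gJ.
pose m x y := wt x * M x y.
have crossE : dotw wt (push g) g = \sum_x \sum_y m x y * (g x * g y).
  rewrite exchange_big; apply: eq_bigr => y _ /=.
  by rewrite wt_push mulr_suml; apply: eq_bigr => x _; rewrite /m; ring.
have rowE : \sum_x \sum_y m x y * g x ^+ 2 = norm2 wt g.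
  apply: eq_bigr => x _; rewrite -mulr_suml -mulr_sumr M_sum; ring.
have colE : \sum_x \sum_y m x y * g y ^+ 2 <= (1 + A * r ^+ 2) * norm2 wt g.
  rewrite exchange_big mulr_sumr; apply: ler_sum => y _ /=; rewrite -mulr_suml.
  have [jy|jy] := leqP (j y) J; last by rewrite gJ // expr0n !(mulr0, mul0r).
  have := ler_wpM2r (sqr_ge0 (g y)) (wtM jy); rewrite /m; lra.
have formE : \sum_x \sum_y m x y * ((g x - g y) * (g x - g y)) =
    \sum_x \sum_y m x y * g x ^+ 2 + \sum_x \sum_y m x y * g y ^+ 2
    - 2 * \sum_x \sum_y m x y * (g x * g y).
  rewrite mulr_sumr -sumrN -!big_split; apply: eq_bigr => x _ /=.
  rewrite mulr_sumr -sumrN -!big_split; apply: eq_bigr => y _ /=; ring.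
have formle : dform cond g g <= \sum_x \sum_y m x y * ((g x - g y) * (g x - g y)).
  rewrite /dform mulr_sumr; apply: ler_sum => x _.
  rewrite mulr_sumr; apply: ler_sum => y _.
  have [<-|xy] := eqVneq x y; first by rewrite subrr !mulr0.
  have m0 : 0 <= m x y by rewrite mulr_ge0 // ltW // wt_gt0.
  have [jx|] := boolP ((j x <= J)%N || (j y <= J)%N).
    have d0 : 0 <= (g x - g y) * (g x - g y) by rewrite -expr2 sqr_ge0.
    by have := ler_wpM2r d0 (M_cond jx xy); rewrite /m; lra.
  by rewrite negb_or -!ltnNge => /andP[/gJ-> /gJ->]; rewrite subrr !mulr0.
rewrite /energy crossE; lra.
Qed.

(** The two entries of the minimum serve the two parts of a function: 1 its fluctuation inside the
    bands, the Hardy constant its band averages. *)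
Definition coercivity : R := Num.min 1 (hardy_const w c / 4) / (16 * E).
Definition coercivity_bottom : R := hardy_bottom_const w c / (32 * E).

Lemma E_ge1 : 1 <= E.
Proof. by apply: le_trans E_ge; rewrite -expR0 ler_expR mulr_ge0 // ltW. Qed.

Hypotheses (A_small : A * r <= coercivity) (r_le1 : r <= 1).

(** Split [g] into its band average u and the fluctuation v. The equi-energy form controls v;
    [band_hardy] controls u, whose Metropolis form is bounded by that of [g] and |v|^2. The defect
    of order A r^2 is absorbed because A r is at most [coercivity]. *)
Lemma energy_coercive g : (forall x, (J < j x)%N -> g x = 0) ->
  coercivity / 2 * r * norm2 wt g <=
    2^-1 * dform bcond g g + energy g
      + coercivity_bottom * r * near_bottom h D h0 (band_avg j g).
Proof.
move=> gJ; set u := band_avg j g; have E1 := E_ge1; have r0 := r_gt0.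
have E0 : 0 < E by lra.
have uJ x : (J < j x)%N -> u x = 0.
  move=> jx; rewrite /u /band_avg gJ // big1 ?mulr0 ?if_same // => y /eqP jy.
  by rewrite gJ // jy.
have hardy := band_hardy h_ge0 w_gt0 r_gt0 K_ge0 K_sym K_le1 jP edge_le
  r_small drift_ub c_gt0 drift_lb drift_lb_far (band_avg_band g) uJ.
have var := band_variance jP D_ge0 (ltW w_gt0) g.
set v := (fun x => g x - u x) in var; rewrite -/u in hardy.
have wt0 x : 0 <= wt x by rewrite ltW // wt_gt0.
have v0 := norm2_ge0 v wt0; have u0 := norm2_ge0 u wt0.
have split2 : norm2 wt g <= 2 * norm2 wt u + 2 * norm2 wt v.
  rewrite !mulr_sumr -big_split; apply: ler_sum => x _ /=.
  have := mulr_ge0 (wt0 x) (sqr_ge0 (g x - 2 * u x)); rewrite /v; lra.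
have dsplit : dform cond u u <= 2 * dform cond g g + 4 * norm2 wt v.
  have := dform_le_norm2 v (cond_ge0 h D K_ge0) (cond_sym h D K_sym)
    (sum_cond h D K_ge0 K_le1).
  suff : dform cond u u <= 2 * dform cond g g + 2 * dform cond v v by lra.
  rewrite /dform mulrCA [in X in _ + X]mulrCA -mulrDr ler_wpM2l //.
  rewrite !mulr_sumr -big_split; apply: ler_sum => x _ /=.
  rewrite !mulr_sumr -big_split; apply: ler_sum => y _ /=.
  have := mulr_ge0 (cond_ge0 h D K_ge0 x y) (sqr_ge0 (g x - g y + (v x - v y))).
  rewrite /v; lra.
have en := energy_ge gJ.
have dg := dform_ge0 g (cond_ge0 h D K_ge0).
have dq := dform_ge0 g (band_cond_ge0 h j D).
set X := norm2 wt u in hardy u0 split2 *; set V := norm2 wt v in var v0 split2 dsplit.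
set G := norm2 wt g in split2 en *; set B := near_bottom _ _ _ _ in hardy *.
set Q := dform bcond g g in var dq *; set Dg := dform cond g g in dsplit en dg.
have varE : V <= 2 * E * Q.
  by apply: le_trans var _; rewrite ler_wpM2r // ler_wpM2l.
set k := coercivity; pose hc := hardy_const w c.
have kE : k * (16 * E) = Num.min 1 (hc / 4) by rewrite divfK // gt_eqF // mulr_gt0.
have k0 : 0 < k.
  rewrite divr_gt0 ?mulr_gt0 // lt_min ltr01 divr_gt0 // /hardy_const.
  by rewrite divr_gt0 // mulr_gt0 // s_gt0.
have k1 : 16 * E * k <= 1 by rewrite mulrC kE ge_min lexx.
have k2 : 16 * E * k <= hc / 4 by rewrite mulrC kE ge_min lexx orbT.
(* The Hardy inequality is used with the factor t/4. The half of the equi-energy form is spent in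
   two quarters: one on the |v|^2 created in passing from u to g ([s2]), one on v itself ([s6]). *)
pose t := (8 * E)^-1; have tE : t * E = 8^-1 by rewrite /t; field; rewrite gt_eqF.
have t0 : 0 < t by rewrite invr_gt0 mulr_gt0.
have t1 : t <= 1 by nra.
have cbE : coercivity_bottom = t / 4 * hardy_bottom_const w c.
  by rewrite /coercivity_bottom /t; field; rewrite gt_eqF.
rewrite cbE.
have s1 : t / 2 * Dg <= 2^-1 * Dg by rewrite ler_wpM2r //; lra.
have s2 : t * V <= 4^-1 * Q by have := ler_wpM2l (ltW t0) varE; nra.
have s3 := ler_wpM2l (ltW t0) hardy.
have s4 := ler_wpM2l (ltW t0) dsplit.
have s5 : 2 * k * r * X <= t / 4 * (hc * r * X).
  have : 2 * k <= t / 4 * hc.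
    have := ler_wpM2l (ltW t0) k2; nra.
  have rX : 0 <= r * X by rewrite mulr_ge0 // ltW.
  by move=> /(ler_wpM2r rX); lra.
have s6 : 2 * k * r * V <= 4^-1 * Q.
  have h1 : 2 * k * r * V <= 2 * k * V.
    by rewrite ler_wpM2r // ler_piMr // mulr_ge0 // ltW.
  have h2 : 2 * k * V <= 2 * k * (2 * E * Q) by rewrite ler_wpM2l // mulr_ge0 // ltW.
  have h3 := ler_wpM2r dq k1; lra.
have G0 : 0 <= G by apply: norm2_ge0.
have s7 : A * r ^+ 2 / 2 * G <= k / 2 * r * G.
  rewrite ler_wpM2r //; have := ler_wpM2r (ltW r0) A_small; rewrite -/k; lra.
have s8 : k * r * G <= 2 * k * r * X + 2 * k * r * V.
  have kr : 0 <= k * r by rewrite mulr_ge0 // ltW.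
  have := ler_wpM2l kr split2; lra.
rewrite -/hc in s3; lra.
Qed.

Variable p : R.
Hypotheses (p_ge0 : 0 <= p) (p_half : p <= 2^-1) (p_small : 6 * p <= coercivity * r).

Notation lz := (lazy wt bcond p).

Definition supported (g : T -> R) : Prop := forall x, (J < j x)%N -> g x = 0.

Definition killed_push (g : T -> R) y : R :=
  if (j y <= J)%N then (1 - p) * g y + p * push g y else 0.

Definition step (f : T -> R) : T -> R := lz (killed_push (lz f)).

Let wt0 x : 0 <= wt x. Proof. exact/ltW/wt_gt0. Qed.

Lemma lazy_supported f : supported f -> supported (lz f).
Proof.
move=> fJ x jx; rewrite /lazy /gen fJ // big1 ?mulr0 ?subrr // => y _.
rewrite /band_cond; case: ifP => [/andP[/eqP jxy _]|]; rewrite ?mul0r //.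
by rewrite [f y]fJ ?subrr ?mulr0 // -jxy.
Qed.

Lemma step_supported f : supported (step f).
Proof. by apply: lazy_supported => x jx; rewrite /killed_push leqNgt jx. Qed.

Lemma p01 : 0 <= p <= 1.
Proof. by rewrite p_ge0 (le_trans p_half) // invf_le1 // ler1n. Qed.

Lemma lazy_ge0 f : (forall x, 0 <= f x) -> forall x, 0 <= lz f x.
Proof.
move=> f0 x; have /andP[p0 p1] := p01; have wx := wt_gt0 h D x.
have -> : lz f x = f x * (1 - p * ((wt x)^-1 * \sum_y bcond x y)) +
    p * ((wt x)^-1 * \sum_y bcond x y * f y).
  rewrite /lazy /gen.
  have -> : \sum_y bcond x y * (f x - f y) =
      f x * \sum_y bcond x y - \sum_y bcond x y * f y.
    by rewrite mulr_sumr -sumrN -big_split; apply: eq_bigr => y _ /=; ring.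
  ring.
have q0 y : 0 <= bcond x y by apply: band_cond_ge0.
have qs := sum_band_cond h j D x.
apply: addr_ge0; last first.
  rewrite mulr_ge0 // mulr_ge0 ?invr_ge0 ?(ltW wx) // sumr_ge0 // => y _.
  by rewrite mulr_ge0.
rewrite mulr_ge0 // subr_ge0 (le_trans _ p1) // ler_piMr // ler_pdivrMl ?mulr1 //.
Qed.

Lemma push_ge0 g : (forall x, 0 <= g x) -> forall x, 0 <= push g x.
Proof.
move=> g0 x; rewrite mulr_ge0 ?invr_ge0 ?wt0 // sumr_ge0 // => y _.
by rewrite mulr_ge0 // mulr_ge0 // wt0.
Qed.

Lemma killed_push_ge0 g : (forall x, 0 <= g x) -> forall x, 0 <= killed_push g x.
Proof.
move=> g0 x; have /andP[p0 p1] := p01; rewrite /killed_push; case: ifP => // _.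
by rewrite addr_ge0 // mulr_ge0 ?subr_ge0 // push_ge0.
Qed.

Lemma step_ge0 f : (forall x, 0 <= f x) -> forall x, 0 <= step f x.
Proof. by move=> f0; apply/lazy_ge0/killed_push_ge0/lazy_ge0. Qed.

(** Jensen with the column weights [wt x * M x y]; their sum is controlled by [wtM] only for [y]
    inside the trap, hence the restricted sum. *)
Lemma norm2_push g : \sum_(y | (j y <= J)%N) wt y * push g y ^+ 2 <=
  (1 + A * r ^+ 2) * norm2 wt g.
Proof.
have -> : (1 + A * r ^+ 2) * norm2 wt g =
    \sum_y (1 + A * r ^+ 2) * \sum_x wt x * M x y * g x ^+ 2.
  rewrite -mulr_sumr exchange_big; congr (_ * _); apply: eq_bigr => x _ /=.
  by rewrite -mulr_suml -mulr_sumr M_sum; ring.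
rewrite [leLHS]big_mkcond; apply: ler_sum => y _.
have sq_ge0 : 0 <= \sum_x wt x * M x y * g x ^+ 2.
  by apply: sumr_ge0 => x _; rewrite mulr_ge0 ?sqr_ge0 // mulr_ge0 // wt0.
have A1 : 0 < 1 + A * r ^+ 2 by rewrite ltr_pwDl // mulr_ge0 ?sqr_ge0.
case: ifP => [jy|_]; last by rewrite mulr_ge0 // ltW.
have wy := wt_gt0 h D y.
have b0 : 0 < (1 + A * r ^+ 2) * wt y by rewrite mulr_gt0.
have a0 x : 0 <= wt x * M x y by rewrite mulr_ge0 // wt0.
have := weighted_cauchy_schwarz g b0 a0 (wtM jy).
move=> cs; rewrite -(ler_pM2l wy).
have -> : wt y * (wt y * push g y ^+ 2) = (wt y * push g y) ^+ 2 by ring.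
rewrite wt_push; have := cs; under eq_bigr => x _ do rewrite mulrAC.
by rewrite [in X in _ -> X]mulrA [wt y * _]mulrC.
Qed.

(** The first lazy step dissipates p times the equi-energy form, the killed step 2p times [energy]:
    together 2p times what [energy_coercive] bounds from below, up to the bottom term. The resulting
    gain p * [coercivity] * r * |g|^2 pays for the terms in p^2 by [p_small]. The last lazy step is
    a contraction. *)
Lemma norm2_step f : supported f ->
  norm2 wt (step f) <= norm2 wt f +
    2 * p * coercivity_bottom * r * near_bottom h D h0 (band_avg j (lz f)).
Proof.
move=> fJ; set g := lz f; have gJ : supported g by apply: lazy_supported.
have /andP[p0 p1] := p01; have r0 := r_gt0.
have q0 x y : 0 <= bcond x y by apply: band_cond_ge0.
have qC x y : bcond x y = bcond y x by apply: band_cond_sym.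
have qs x : \sum_y bcond x y <= wt x by apply: sum_band_cond.
have lazyN u := norm2_lazy p (wt_gt0 h D) q0 qC qs u.
set B := near_bottom _ _ _ _.
have co := energy_coercive gJ; rewrite -/B in co.
have N0 := norm2_ge0 g wt0.
have dq := dform_ge0 g q0.
(* Since p <= 1/2, the coefficient 2p(1-p) is at least p; [dform_lazy] then replaces the form of f
   by that of g. *)
have gf : norm2 wt g <= norm2 wt f - p * dform bcond g g.
  have := lazyN f; rewrite -/g; have := dform_lazy (wt_gt0 h D) q0 qC qs p01 f.
  rewrite -/g => d1.
  have : 0 <= p * (1 - 2 * p) * dform bcond g g.
    by rewrite mulr_ge0 // mulr_ge0 //; have := p_half; lra.
  have : 0 <= p * (1 - p) by rewrite mulr_ge0 // subr_ge0.
  move=> /ler_wpM2l-/(_ _ _ d1); lra.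
have step_k : norm2 wt (step f) <= norm2 wt (killed_push g).
  apply: le_trans (lazyN _) _; rewrite lerBlDr lerDl.
  rewrite mulr_ge0 ?dform_ge0 // mulr_ge0 ?subr_ge0 // mulr_ge0 //.
have kill : norm2 wt (killed_push g) <=
    norm2 wt g - 2 * p * energy g + 6 * p ^+ 2 * norm2 wt g.
  pose v := \sum_(y | (j y <= J)%N) wt y * (g y - push g y) ^+ 2.
  have -> : norm2 wt (killed_push g) = norm2 wt g - 2 * p * energy g + p ^+ 2 * v.
    rewrite /energy /norm2 /dotw /v [X in p ^+ 2 * X]big_mkcond mulrBr !mulr_sumr.
    rewrite opprB addrA -sumrN -!big_split; apply: eq_bigr => y _ /=.
    rewrite /killed_push; case: leqP => jy; first by ring.
    by rewrite gJ // !(mulr0, mul0r, subr0, addr0).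
  rewrite lerD2l -[leRHS]mulrA [leRHS]mulrCA; apply: ler_wpM2l; first exact: sqr_ge0.
  have : v <= 2 * norm2 wt g + 2 * \sum_(y | (j y <= J)%N) wt y * push g y ^+ 2.
    have -> : norm2 wt g = \sum_(y | (j y <= J)%N) wt y * g y ^+ 2.
      rewrite [RHS]big_mkcond; apply: eq_bigr => y _; case: leqP => jy; first by ring.
      by rewrite gJ // !mulr0.
    rewrite !mulr_sumr -big_split; apply: ler_sum => y _ /=.
    have := mulr_ge0 (wt0 y) (sqr_ge0 (g y + push g y)); lra.
  have := norm2_push g.
  have : A * r ^+ 2 <= 1.
    have k1 : coercivity <= 1.
      rewrite /coercivity ler_pdivrMr ?mulr_gt0 // ?(lt_le_trans ltr01 E_ge1) //.
      rewrite mul1r (@le_trans _ _ 1) ?ge_min ?lexx //.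
      by have := E_ge1; lra.
    by have := A_small; have := r_le1; nra.
  move=> /(ler_wpM2r N0); lra.
have psm : 6 * p ^+ 2 * norm2 wt g <= p * coercivity * r * norm2 wt g.
  by rewrite ler_wpM2r //; have := ler_wpM2l p0 p_small; lra.
have := ler_wpM2l p0 co; lra.
Qed.

Definition total : R := \sum_(x | (j x <= J)%N) wt x.

(** The pointwise bound is needed up to [h0 + w] because the band of a state below [h0] may contain
    states that are higher by up to [w]. *)
Lemma near_bottom_le g peak : supported g -> (forall x, 0 <= g x) ->
    (forall x, h x < h0 + w -> g x <= peak) -> 0 <= peak ->
  near_bottom h D h0 (band_avg j g) <= peak ^+ 2 * total.
Proof.
move=> gJ g0 gF peak0; rewrite mulr_sumr /near_bottom [leLHS]big_mkcond [leRHS]big_mkcond.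
apply: ler_sum => x _.
have [jx|jx] := leqP (j x) J; last first.
  case: ifP => // _; rewrite /band_avg gJ // big1 ?mulr0 ?if_same ?expr0n ?mulr0 //.
  by move=> y /eqP jy; rewrite gJ // jy.
case: ifP => [hx|_]; last by rewrite mulr_ge0 ?sqr_ge0 // wt0.
rewrite mulrC ler_wpM2r ?wt0 // !expr2.
suff /andP[a0 aF] : 0 <= band_avg j g x <= peak by apply: ler_pM.
rewrite /band_avg; case: ifP => _.
  by rewrite g0 gF // ltr_wpDr // ltW.
have n0 : 0 < band_size j x :> R by apply: band_size_gt0.
rewrite mulr_ge0 ?invr_ge0 ?(ltW n0) ?sumr_ge0 //=.
rewrite ler_pdivrMl // -sum_band; apply: ler_sum => y /eqP jy; apply: gF.
have /andP[+ _] := jP x; have /andP[_] := jP y; rewrite jy; lra.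
Qed.

Definition act (F : T -> R) x : R := (1 - p) * F x + p * \sum_y M x y * F y.

(** Evolution of observables, without killing; [step] is its adjoint in L2 of [wt], killed outside
    the bands of index at most [J]. *)
Definition chain (F : T -> R) : T -> R := lz (act (lz F)).

Definition inside x : R := (j x <= J)%N%:R.

Lemma dotw_lazy f F : dotw wt (lz f) F = dotw wt f (lz F).
Proof.
have q0 x y : 0 <= bcond x y by apply: band_cond_ge0.
have qC x y : bcond x y = bcond y x by apply: band_cond_sym.
have genC : dotw wt (gen wt bcond f) F = dotw wt f (gen wt bcond F).
  rewrite (dotw_gen (wt_gt0 h D) qC).
  rewrite [RHS](_ : _ = dotw wt (gen wt bcond F) f); last first.
    by apply: eq_bigr => x _; ring.
  rewrite (dotw_gen (wt_gt0 h D) qC) /dform; congr (_ * _).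
  by apply: eq_bigr => x _; apply: eq_bigr => y _; ring.
have -> : dotw wt (lz f) F = dotw wt f F - p * dotw wt (gen wt bcond f) F.
  rewrite /dotw mulr_sumr -sumrN -big_split; apply: eq_bigr => x _ /=.
  by rewrite /lazy; ring.
rewrite genC /dotw mulr_sumr -sumrN -big_split; apply: eq_bigr => x _ /=.
by rewrite /lazy; ring.
Qed.

Lemma dotw_act g F :
  dotw wt g (act F) = \sum_y wt y * ((1 - p) * g y + p * push g y) * F y.
Proof.
have -> : \sum_y wt y * ((1 - p) * g y + p * push g y) * F y =
    \sum_y (1 - p) * (wt y * g y * F y) +
    p * \sum_y \sum_x wt x * g x * M x y * F y.
  rewrite mulr_sumr -big_split; apply: eq_bigr => y _ /=.
  by rewrite -mulr_suml -wt_push; ring.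
rewrite exchange_big mulr_sumr -big_split; apply: eq_bigr => x _ /=.
rewrite /act mulrDr; congr (_ + _); first by ring.
rewrite mulrCA mulr_sumr; congr (_ * _); apply: eq_bigr => y _; ring.
Qed.

Lemma act_ge0 F : (forall x, 0 <= F x) -> forall x, 0 <= act F x.
Proof.
move=> F0 x; have /andP[p0 p1] := p01.
rewrite addr_ge0 // mulr_ge0 ?subr_ge0 // sumr_ge0 // => y _.
by rewrite mulr_ge0.
Qed.

Lemma chain_ge0 F : (forall x, 0 <= F x) -> forall x, 0 <= chain F x.
Proof. by move=> F0; apply/lazy_ge0/act_ge0/lazy_ge0. Qed.

(** Both lazy factors are self-adjoint for [wt] and the middle ones are adjoint up to killing, which
    can only lower the pairing of nonnegative functions. *)
Lemma dotw_step_le f F : (forall x, 0 <= f x) -> (forall x, 0 <= F x) ->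
  dotw wt (step f) F <= dotw wt f (chain F).
Proof.
move=> f0 F0; have g0 := lazy_ge0 f0; have G0 := lazy_ge0 F0.
have /andP[p0 p1] := p01.
rewrite /step /chain dotw_lazy -[leRHS]dotw_lazy dotw_act.
apply: ler_sum => y _; rewrite ler_wpM2r // ler_wpM2l ?wt0 // /killed_push.
have pg := push_ge0 g0 y.
by case: ifP => // _; rewrite addr_ge0 // mulr_ge0 // subr_ge0.
Qed.

Lemma dotw_iter_step_le t f F : (forall x, 0 <= f x) -> (forall x, 0 <= F x) ->
  dotw wt (iter t step f) F <= dotw wt f (iter t chain F).
Proof.
elim: t f => [//|t IH] f f0 F0; rewrite iterSr iterS.
apply: le_trans (IH _ (step_ge0 f0) F0) _; apply: dotw_step_le => //.
by elim: t {IH} => [//|t IH] x; rewrite iterS; apply: chain_ge0.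
Qed.

Lemma lazy_const a : lz (fun=> a) = fun=> a.
Proof.
apply/funext => x; rewrite /lazy /gen big1 ?mulr0 ?subr0 // => y _.
by rewrite subrr mulr0.
Qed.

Lemma mass_lazy f : dotw wt (lz f) (fun=> 1) = dotw wt f (fun=> 1).
Proof. by rewrite dotw_lazy lazy_const. Qed.

Variable Top : pred T.
Hypothesis exit_top : forall x y, (j x <= J)%N -> (J < j y)%N -> M x y != 0 -> Top x.

(** The lazy steps preserve mass, so the loss occurs in the middle step only, from states of [Top],
    and with probability at most p. *)
Lemma mass_step f : supported f -> (forall x, 0 <= f x) ->
  dotw wt f (fun=> 1) - p * \sum_x wt x * (Top x)%:R * lz f x <=
    dotw wt (step f) (fun=> 1).
Proof.
move=> fJ f0; have g0 := lazy_ge0 f0; have gJ := lazy_supported fJ.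
rewrite /step mass_lazy -[X in X - _ <= _]mass_lazy; set g := lz f in g0 gJ *.
have /andP[p0 p1] := p01.
have -> : dotw wt (killed_push g) (fun=> 1) = dotw wt g (act inside).
  rewrite dotw_act; apply: eq_bigr => y _; rewrite /killed_push /inside.
  by case: ifP; rewrite ?mulr0 ?mul0r.
rewrite mulr_sumr -sumrN -big_split; apply: ler_sum => x _ /=.
have [jx|jx] := leqP (j x) J; last by rewrite gJ // !(mulr0, mul0r) subr0.
have sumG : 1 - (Top x)%:R <= \sum_y M x y * inside y.
  have M0 : 0 <= \sum_y M x y * inside y.
    by apply: sumr_ge0 => y _; rewrite mulr_ge0.
  have [//|nT] := boolP (Top x); first by rewrite subrr.
  rewrite subr0 -(M_sum x); apply: ler_sum => y _; rewrite /inside.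
  have [jy|jy] := leqP (j y) J; first by rewrite mulr1.
  rewrite mulr0; have [->//|My] := eqVneq (M x y) 0.
  by rewrite (exit_top jx jy My) in nT.
have wg : 0 <= wt x * g x by rewrite mulr_ge0 ?wt0.
have := ler_wpM2l wg (ler_wpM2l p0 sumG); rewrite /act {2}/inside jx /= ?mulr1n; lra.
Qed.

(** [Inv] will be invariance under site permutations, whose purpose is the pointwise bound
    [Inv_bottom]. [tau] bounds the weight of the exit layer and [theta] sets the resulting rate of
    loss. *)
Variables (Inv : (T -> R) -> Prop) (peak tau theta : R).
Hypothesis Inv_lazy : forall f, Inv f -> Inv (lz f).
Hypothesis Inv_killed : forall f, Inv f -> Inv (killed_push f).
Hypothesis Inv_inside : Inv inside.
Hypothesis Inv_bottom : forall g, Inv g -> (forall x, 0 <= g x) ->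
  dotw wt g (fun=> 1) <= total -> forall x, h x < h0 + w -> g x <= peak.
Hypotheses (peak_ge0 : 0 <= peak) (tau_gt0 : 0 < tau) (theta_ge0 : 0 <= theta).
Hypothesis Top_small : \sum_x wt x * (Top x)%:R <= tau.
Hypothesis tau_small : tau * (1 + coercivity_bottom * peak ^+ 2) <= theta ^+ 2 * total.

Lemma total_ge0 : 0 <= total.
Proof. by apply: sumr_ge0 => x _; apply: wt0. Qed.

Lemma mass_inside : dotw wt inside (fun=> 1) = total.
Proof.
rewrite /total big_mkcond; apply: eq_bigr => x _; rewrite /inside.
by case: ifP; rewrite !mulr1 ?mulr0.
Qed.

Lemma norm2_inside : norm2 wt inside = total.
Proof.
rewrite -mass_inside; apply: eq_bigr => x _; rewrite /inside.
by case: (_ <= _)%N; rewrite !(mulr1, mulr0).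
Qed.

Lemma coercivity_bottom_ge0 : 0 <= coercivity_bottom.
Proof.
have E1 := E_ge1.
have hb : 0 <= hardy_bottom_const w c.
  rewrite /hardy_bottom_const divr_ge0 // mulr_ge0 //; last by rewrite addr_ge0 ?ltW.
  exact/ltW/s_gt0.
by rewrite divr_ge0 // mulr_ge0 //; lra.
Qed.

(** The bounds need each other: bounded mass feeds [Inv_bottom], which gives linear growth of the
    squared norm, which by Cauchy-Schwarz puts a mass of at most theta * total * (t + 1) on [Top] at
    time t. Summing over time yields the quadratic loss. *)
Lemma iterates t : let f := iter t step inside in
  [/\ Inv f, supported f, (forall x, 0 <= f x),
      norm2 wt f <= total * (1 + t%:R * (coercivity_bottom * peak ^+ 2)) &
      total * (1 - theta * t%:R * (t%:R + 1)) <= dotw wt f (fun=> 1) <= total].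
Proof.
have cb0 := coercivity_bottom_ge0; have W0 := total_ge0.
have /andP[p0 p1] := p01.
elim: t => [|t] /=.
  split=> //; first by move=> x jx; rewrite /inside leqNgt jx.
  - by rewrite norm2_inside mul0r addr0 mulr1.
  - by rewrite mass_inside mulr0 mul0r subr0 mulr1 lexx.
set f := iter t step inside; move=> [If fJ f0 fN /andP[fM fm]].
have g0 := lazy_ge0 f0; have Ig := Inv_lazy If; have gJ := lazy_supported fJ.
have gm : dotw wt (lz f) (fun=> 1) <= total by rewrite mass_lazy.
have gF := Inv_bottom Ig g0 gm.
have nb := near_bottom_le gJ g0 gF peak_ge0.
have cF : 0 <= coercivity_bottom * peak ^+ 2 by rewrite mulr_ge0 ?sqr_ge0.
split.
- exact/Inv_lazy/Inv_killed.
- exact: step_supported.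
- exact: step_ge0.
- have := norm2_step fJ.
  have pr : 2 * p * r <= 1.
    by have := r_gt0; have := r_le1; have := p_half; nra.
  have pr0 : 0 <= 2 * p * r by rewrite !mulr_ge0 // ltW.
  have := ler_wpM2l (mulr_ge0 pr0 cb0) nb.
  have := ler_wpM2r (mulr_ge0 cF W0) pr.
  rewrite -natr1; lra.
apply/andP; split; last first.
  apply: le_trans (dotw_step_le f0 (fun=> ler01)) _.
  rewrite /chain lazy_const (_ : act _ = fun=> 1) ?lazy_const //.
  apply/funext => x; rewrite /act; under eq_bigr do rewrite mulr1.
  by rewrite M_sum; ring.
have ms := mass_step fJ f0; set l := \sum_x _ * lz f x in ms.
have gN : norm2 wt (lz f) <= norm2 wt f.
  have q0 x y : 0 <= bcond x y by apply: band_cond_ge0.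
  have qC x y : bcond x y = bcond y x by apply: band_cond_sym.
  have qs x : \sum_y bcond x y <= wt x by apply: sum_band_cond.
  have := norm2_lazy p (wt_gt0 h D) q0 qC qs f.
  move=> /le_trans; apply; rewrite gerBl.
  by rewrite mulr_ge0 ?dform_ge0 // mulr_ge0 ?subr_ge0 // mulr_ge0.
have l0 : 0 <= l by apply: sumr_ge0 => x _; rewrite mulr_ge0 // mulr_ge0 ?wt0.
have l2 : l ^+ 2 <= tau * norm2 wt (lz f).
  have a0 x : 0 <= wt x * (Top x)%:R by rewrite mulr_ge0 ?wt0.
  apply: le_trans (weighted_cauchy_schwarz _ tau_gt0 a0 Top_small) _.
  rewrite ler_pM2l //; apply: ler_sum => x _; rewrite -[leRHS]mulrA -expr2.
  by rewrite ler_wpM2r ?sqr_ge0 // ler_piMr ?wt0 // lern1; case: (Top x).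
have l3 : l <= theta * total * (t%:R + 1).
  rewrite -(@ler_pXn2r _ 2) ?nnegrE //; last by rewrite !mulr_ge0 // addr_ge0.
  apply: le_trans l2 _.
  have t1 : 1 + t%:R * (coercivity_bottom * peak ^+ 2) <=
      (t%:R + 1) * (1 + coercivity_bottom * peak ^+ 2).
    have := ler0n R t; lra.
  have h1 : norm2 wt (lz f) <=
      total * ((t%:R + 1) * (1 + coercivity_bottom * peak ^+ 2)).
    by apply: (le_trans gN); apply: (le_trans fN); apply: ler_wpM2l.
  have := ler_wpM2l (ltW tau_gt0) h1.
  have tw : 0 <= total * (t%:R + 1) by rewrite mulr_ge0 // addr_ge0.
  have := ler_wpM2l tw tau_small.
  have : 0 <= theta ^+ 2 * total ^+ 2 * ((t%:R + 1) * t%:R).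
    by rewrite mulr_ge0 ?mulr_ge0 ?sqr_ge0 // addr_ge0.
  lra.
have : p * l <= l by rewrite ler_piMl.
have : 0 <= theta * total * (t%:R + 1) by rewrite !mulr_ge0 // addr_ge0.
rewrite -natr1; lra.
Qed.

Lemma survival t : total * (1 - theta * t%:R * (t%:R + 1)) <=
  dotw wt inside (iter t chain inside).
Proof.
have [_ fJ f0 _ /andP[fM _]] := iterates t.
have i0 x : 0 <= inside x by [].
apply: le_trans (dotw_iter_step_le t i0 i0); apply: (le_trans fM).
apply: ler_sum => x _; rewrite mulr1 /inside.
by have [jx|jx] := leqP (j x) J; rewrite ?mulr1 // fJ // mulr0 mul0r.
Qed.

End OneStep.

(** * The Potts model and its Metropolis dynamics *)

Section Occupation.
Context {R : realType} {N : nat}.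
Implicit Types (x y : Omega N) (i : 'I_N) (a b : 'I_3).

Definition occ x a : R := \sum_i (x i == a)%:R.

Definition upd x i b : Omega N := [ffun k => if k == i then b else x k].

Definition Koff x y : R := if x == y then 0 else Kgen x y.

Definition excess x : R := H x - N%:R / 6.

Lemma sum_delta (T : finType) (F : T -> R) t : \sum_a F a * (t == a)%:R = F t.
Proof.
rewrite (bigD1 t) //= eqxx mulr1 big1 ?addr0 // => a /negPf.
by rewrite eq_sym => ->; rewrite mulr0.
Qed.

Lemma sum_delta1 (T : finType) (t : T) : \sum_a (t == a)%:R = 1 :> R.
Proof. by rewrite -[RHS](sum_delta (fun=> 1) t); under [RHS]eq_bigr do rewrite mul1r. Qed.

Lemma sum_spin x (F : 'I_3 -> R) : \sum_i F (x i) = \sum_a occ x a * F a.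
Proof.
under [RHS]eq_bigr do rewrite mulr_suml.
rewrite exchange_big; apply: eq_bigr => i _ /=.
by rewrite -[LHS]sum_delta; apply: eq_bigr => a _; rewrite mulrC.
Qed.

Lemma sum_occ x : \sum_a occ x a = N%:R.
Proof.
under eq_bigr do rewrite -[occ _ _]mulr1.
by rewrite -(sum_spin x (fun=> 1)) sumr_const card_ord.
Qed.

Lemma HE x : H x = (2 * N%:R)^-1 * \sum_a occ x a ^+ 2 :> R.
Proof.
congr (_ * _); under [RHS]eq_bigr do rewrite expr2.
rewrite -(sum_spin x (fun a => occ x a)); apply: eq_bigr => i _.
by apply: eq_bigr => k _; rewrite eq_sym.
Qed.

Lemma occ_upd x i b a : occ (upd x i b) a = occ x a + (b == a)%:R - (x i == a)%:R.
Proof.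
rewrite /occ (bigD1 i) //= [in RHS](bigD1 i) //= ffunE eqxx.
rewrite (eq_bigr (fun k => (x k == a)%:R)); last by move=> k /negPf; rewrite ffunE => ->.
ring.
Qed.

Hypothesis N_gt0 : (0 < N)%N.

Let N0 : 0 < N%:R :> R. Proof. by rewrite ltr0n. Qed.

Lemma H_upd x i b : b != x i -> H (upd x i b) = H x + (occ x b - occ x (x i) + 1) / N%:R.
Proof.
move=> bx; rewrite !HE.
have -> : \sum_a occ (upd x i b) a ^+ 2 =
    \sum_a occ x a ^+ 2 + 2 * (occ x b - occ x (x i)) + 2.
  have sq a : occ (upd x i b) a ^+ 2 = occ x a ^+ 2 + 2 * (occ x a * (b == a)%:R)
      - 2 * (occ x a * (x i == a)%:R) + (b == a)%:R + (x i == a)%:R.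
    rewrite occ_upd; have [ba|_] := eqVneq b a; have [xa|_] := eqVneq (x i) a.
    - by move: bx; rewrite ba xa eqxx.
    - by rewrite /=; ring.
    - by rewrite /=; ring.
    - by rewrite /=; ring.
  under eq_bigr do rewrite sq.
  by rewrite !big_split /= sumrN -!mulr_sumr !sum_delta !sum_delta1; ring.
by field; rewrite gt_eqF.
Qed.

Lemma excessE x : excess x = (2 * N%:R)^-1 * \sum_a (occ x a - N%:R / 3) ^+ 2.
Proof.
have -> : \sum_a (occ x a - N%:R / 3) ^+ 2 = \sum_a occ x a ^+ 2 - N%:R ^+ 2 / 3.
  have sq a : (occ x a - N%:R / 3) ^+ 2 =
      occ x a ^+ 2 - 2 * (N%:R / 3) * occ x a + (N%:R / 3) ^+ 2 by ring.
  under eq_bigr do rewrite sq.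
  by rewrite !big_split /= sumrN -mulr_sumr sum_occ sumr_const card_ord -mulr_natr; field.
by rewrite /excess HE; field; rewrite gt_eqF.
Qed.

Lemma excess_ge0 x : 0 <= excess x.
Proof.
by rewrite excessE mulr_ge0 ?invr_ge0 ?mulr_ge0 // sumr_ge0 // => a _; rewrite sqr_ge0.
Qed.

(** From (occ - N/3)^2 <= 2 N h; the constant 3/2 is a rational bound for the square root of 2. *)
Lemma occ_near x a r : 0 <= r -> excess x <= r ^+ 2 * N%:R ->
  `|occ x a - N%:R / 3| <= 3 / 2 * r * N%:R.
Proof.
move=> r0; rewrite excessE mulrC ler_pdivrMr ?mulr_gt0 // => hx.
have : (occ x a - N%:R / 3) ^+ 2 <= (3 / 2 * r * N%:R) ^+ 2.
  have : (occ x a - N%:R / 3) ^+ 2 <= \sum_a (occ x a - N%:R / 3) ^+ 2.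
    by rewrite (bigD1 a) //= lerDl sumr_ge0 // => c _; rewrite sqr_ge0.
  move=> /le_trans/(_ hx)/le_trans; apply.
  have := mulr_ge0 (sqr_ge0 r) (sqr_ge0 N%:R); lra.
by rewrite -[X in X <= _]real_normK ?num_real // ler_pXn2r // nnegrE ?mulr_ge0.
Qed.

Lemma Kgen_sym x y : Kgen x y = Kgen y x :> R.
Proof.
rewrite /Kgen (eq_sym x) (eq_card (B := [pred i | y i != x i])) // => i.
by rewrite !inE eq_sym.
Qed.

Lemma Koff_sym x y : Koff x y = Koff y x.
Proof. by rewrite /Koff Kgen_sym eq_sym. Qed.

Lemma Koff_ge0 x y : 0 <= Koff x y.
Proof.
by rewrite /Koff /Kgen; case: eqP => // _; case: ifP.
Qed.

Lemma updE x y i b : b != x i ->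
  (y == upd x i b) = (b == y i) && ([set k | x k != y k] == [set i]).
Proof.
move=> bx; apply/eqP/andP => [->|[/eqP-> /eqP /setP d]].
  rewrite ffunE eqxx eqxx; split=> //; apply/eqP/setP => k; rewrite !inE ffunE.
  by have [->|_] := eqVneq k i; rewrite ?eqxx // eq_sym.
apply/ffunP => k; rewrite ffunE; case: eqP => [->//|/eqP ki].
by have := d k; rewrite !inE (negPf ki) => /negbFE/eqP.
Qed.

Lemma KoffE x y :
  Koff x y = (4 * N%:R)^-1 * \sum_i \sum_(b | b != x i) (y == upd x i b)%:R.
Proof.
have -> : \sum_i \sum_(b | b != x i) (y == upd x i b)%:R =
    \sum_i ([set k | x k != y k] == [set i])%:R :> R.
  apply: eq_bigr => i _.
  rewrite (eq_bigr (fun b => ((b == y i) && ([set k | x k != y k] == [set i]))%:R));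
    last by move=> b bx; rewrite updE.
  have [d|_] := eqVneq; last by rewrite big1 // => b _; rewrite andbF.
  have yi : y i != x i by rewrite eq_sym; move/setP/(_ i): d; rewrite !inE eqxx.
  rewrite (bigD1 (y i)) //= eqxx big1 ?addr0 // => b /andP[_ /negPf->] //.
rewrite /Koff /Kgen.
have cE : #|[pred i | x i != y i]| = #|[set k | x k != y k]|.
  by apply: eq_card => k; rewrite !inE.
case: ifP => [/eqP->|xy].
  rewrite big1 ?mulr0 // => i _; case: eqP => // /setP/(_ i).
  by rewrite !inE !eqxx.
rewrite xy cE; have [/cards1P[i ->]|c1] := boolP (#|_| == 1)%N.
  rewrite (bigD1 i) //= eqxx big1 ?addr0 ?mulr1 // => k /negPf ki.
  case: eqP => // /setP/(_ k); rewrite !inE eqxx => /eqP kk.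
  by rewrite kk eqxx in ki.
rewrite big1 ?mulr0 // => i _; case: eqP => // e.
by rewrite e cards1 in c1.
Qed.

Lemma sum_Koff x (F : Omega N -> R) :
  \sum_y Koff x y * F y = (4 * N%:R)^-1 * \sum_i \sum_(b | b != x i) F (upd x i b).
Proof.
under eq_bigr do rewrite KoffE -mulrA mulr_suml.
rewrite -mulr_sumr exchange_big; congr (_ * _); apply: eq_bigr => i _ /=.
under eq_bigr do rewrite mulr_suml.
rewrite exchange_big; apply: eq_bigr => b _ /=.
rewrite -[RHS]sum_delta; apply: eq_bigr => y _.
by rewrite mulrC eq_sym.
Qed.

Lemma Koff_neq0 x y : Koff x y != 0 -> exists i b, b != x i /\ y = upd x i b.
Proof.
rewrite KoffE mulf_eq0 negb_or => /andP[_].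
move=> /eqP s0; apply: contrapT => nex; apply: s0; apply: big1 => i _.
apply: big1 => b bx; case: eqP => // yb; case: nex; by exists i, b.
Qed.

Lemma Koff_sum1 x : \sum_y Koff x y = 2^-1.
Proof.
under eq_bigr do rewrite -[Koff _ _]mulr1.
rewrite (sum_Koff x (fun=> 1)).
have -> : \sum_i \sum_(b | b != x i) 1 = 2 * N%:R :> R.
  transitivity (\sum_(i < N) (2 : R)); last by rewrite sumr_const card_ord -[LHS]mulr_natr.
  apply: eq_bigr => i _; have := cardC1 (x i); rewrite card_ord => c2.
  by rewrite sumr_const c2.
by field; rewrite gt_eqF.
Qed.

(** [H] is quadratic in the occupation numbers, so the drift under the unbiased proposal is affine
    in the excess: entropy pulls it down at rate 3/2, and the 1 in [H_upd] leaves the constant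
    1/(2N), which wins only when the excess is below 1/3. *)
Lemma mean_jump x :
  \sum_y Koff x y * (excess y - excess x) = (2 * N%:R)^-1 - 3 / 2 * (excess x / N%:R).
Proof.
rewrite sum_Koff.
have jump i b : b != x i ->
    excess (upd x i b) - excess x = (occ x b - occ x (x i) + 1) / N%:R.
  by move=> bx; rewrite /excess H_upd //; ring.
have -> : \sum_i \sum_(b | b != x i) (excess (upd x i b) - excess x) =
    \sum_i (N%:R + 2 - 3 * occ x (x i)) / N%:R.
  apply: eq_bigr => i _; rewrite (eq_bigr _ (jump i)) -mulr_suml; congr (_ / _).
  have := sum_occ x; rewrite (bigD1 (x i)) //= => <-.
  have := cardC1 (x i); rewrite card_ord /= => c2.
  rewrite big_split /= big_split /= !sumr_const c2. ring.
rewrite -mulr_suml (sum_spin x (fun a => N%:R + 2 - 3 * occ x a)).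
have -> : \sum_a occ x a * (N%:R + 2 - 3 * occ x a) =
    (N%:R + 2) * N%:R - 3 * (2 * N%:R * H x).
  have e a : occ x a * (N%:R + 2 - 3 * occ x a) =
      (N%:R + 2) * occ x a - 3 * occ x a ^+ 2 by ring.
  under eq_bigr do rewrite e.
  by rewrite big_split /= sumrN -!mulr_sumr sum_occ HE; field; rewrite gt_eqF.
by rewrite /excess; field; rewrite gt_eqF.
Qed.

(** For each pair of colours only one direction lowers the energy, so half of the squared
    differences count. This is the leading 1/2, hence the drift coefficient (3 - D)/2 and the
    threshold 3. *)
Lemma down_jump2 x r : (forall a, occ x a <= (1 / 3 + r) * N%:R) ->
  \sum_y Koff x y * Num.max 0 (excess x - excess y) ^+ 2 <=
    (1 / 2 + 3 / 2 * r) * (excess x / N%:R).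
Proof.
move=> occr; rewrite sum_Koff.
pose d a b := Num.max 0 (occ x a - occ x b).
have d2 a b : d a b ^+ 2 + d b a ^+ 2 = (occ x a - occ x b) ^+ 2.
  rewrite /d !maxEle; case: ifP => h1; case: ifP => h2; try ring; try lra.
  have -> : occ x a = occ x b by lra.
  ring.
have le1 : \sum_i \sum_(b | b != x i) Num.max 0 (excess x - excess (upd x i b)) ^+ 2 <=
    \sum_i \sum_b (d (x i) b / N%:R) ^+ 2.
  apply: ler_sum => i _; rewrite [leLHS]big_mkcond; apply: ler_sum => b _.
  case: ifP => [bx|_]; last by rewrite sqr_ge0.
  rewrite ler_pXn2r ?nnegrE ?le_max ?lexx //; last first.
    by rewrite divr_ge0 ?(ltW N0) // le_max lexx.
  rewrite /excess H_upd // ge_max divr_ge0 ?(ltW N0) ?le_max ?lexx //=.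
  rewrite ler_pdivlMr // /d le_max; apply/orP; right.
  have -> : (H x - N%:R / 6 - (H x + (occ x b - occ x (x i) + 1) / N%:R - N%:R / 6)) * N%:R
     = occ x (x i) - occ x b - 1 by field; rewrite gt_eqF.
  lra.
have le2 : \sum_i \sum_b (d (x i) b / N%:R) ^+ 2 <=
    (1 / 3 + r) * N%:R * (6 * excess x / N%:R).
  rewrite (sum_spin x (fun a => \sum_b (d a b / N%:R) ^+ 2)).
  apply: (@le_trans _ _ (\sum_a (1 / 3 + r) * N%:R * \sum_b (d a b / N%:R) ^+ 2)).
    by apply: ler_sum => a _; rewrite ler_wpM2r // sumr_ge0 // => b _; rewrite sqr_ge0.
  rewrite -mulr_sumr; set S := \sum_a _.
  suff -> : S = 6 * excess x / N%:R by [].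
  have S2 : S + S = \sum_a \sum_b (occ x a - occ x b) ^+ 2 / N%:R ^+ 2.
    rewrite {2}/S exchange_big -big_split /=; apply: eq_bigr => a _.
    rewrite -big_split /=; apply: eq_bigr => b _.
    by rewrite -d2; field; rewrite gt_eqF.
  have S3 : \sum_a \sum_b (occ x a - occ x b) ^+ 2 = 12 * N%:R * excess x.
    have sq a b : (occ x a - occ x b) ^+ 2 =
        occ x a ^+ 2 - 2 * occ x a * occ x b + occ x b ^+ 2 by ring.
    have in_sum a : \sum_b (occ x a - occ x b) ^+ 2 =
        3 * occ x a ^+ 2 - 2 * N%:R * occ x a + 2 * N%:R * H x.
      have lin : \sum_b 2 * occ x a * occ x b = 2 * occ x a * N%:R.
        by rewrite -mulr_sumr sum_occ.
      under eq_bigr do rewrite sq.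
      rewrite !big_split /= sumrN lin sumr_const card_ord -mulr_natl HE.
      by field; rewrite gt_eqF.
    have lin : \sum_a 2 * N%:R * occ x a = 2 * N%:R * N%:R.
      by rewrite -mulr_sumr sum_occ.
    have quad : \sum_a 3 * occ x a ^+ 2 = 3 * \sum_a occ x a ^+ 2.
      by rewrite -mulr_sumr.
    under eq_bigr do rewrite in_sum.
    rewrite !big_split /= sumrN lin quad sumr_const card_ord -mulr_natl.
    have -> : \sum_a occ x a ^+ 2 = 2 * N%:R * H x by rewrite HE; field; rewrite gt_eqF.
    by rewrite /excess; field.
  have : S + S = 12 * N%:R * excess x / N%:R ^+ 2.
    by rewrite S2 -S3 mulr_suml; apply: eq_bigr => a _; rewrite mulr_suml.
  move=> SS; have -> : S = (S + S) / 2 by field.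
  by rewrite SS; field; rewrite gt_eqF.
rewrite ler_pdivrMl ?mulr_gt0 //; apply: (le_trans (le_trans le1 le2)).
rewrite le_eqVlt; apply/orP; left; apply/eqP; field; rewrite gt_eqF //.
Qed.

Lemma edge_jump x y r : 0 <= r -> N%:R^-1 <= r -> excess x <= r ^+ 2 * N%:R ->
  Koff x y != 0 -> `|excess x - excess y| <= 4 * r.
Proof.
move=> r0 Nr hx /Koff_neq0[i [b [bx ->]]].
have -> : excess x - excess (upd x i b) =
    ((occ x (x i) - N%:R / 3) - (occ x b - N%:R / 3) - 1) / N%:R.
  by rewrite /excess H_upd //; ring.
have := occ_near b r0 hx; have := occ_near (x i) r0 hx.
rewrite !ler_norml => /andP[a1 a2] /andP[b1 b2].
have N1 : 1 <= r * N%:R by rewrite -ler_pdivrMr // div1r.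
by rewrite ler_pdivlMr // ler_pdivrMr //; apply/andP; split; lra.
Qed.

End Occupation.

(** * The Metropolis chain at [beta] seen from the weight e^(D h) *)

Section MetropolisDynamics.
Context {R : realType} {N : nat}.
Variables (beta D r : R).
Hypotheses (N_gt0 : (0 < N)%N) (D_ge0 : 0 <= D) (D_le : D <= beta) (beta_lt3 : beta < 3).
Hypotheses (r_ge0 : 0 <= r) (Nr : N%:R^-1 <= r).
Implicit Types (x y : Omega N).

Notation h := (@excess R N).
Notation K := (@Koff R N).
Notation wt := (weight h D).

Let N0 : 0 < N%:R :> R. Proof. by rewrite ltr0n. Qed.

Lemma wtD x y : wt y = wt x * expR (D * (h y - h x)).
Proof. by rewrite /weight -expRD; congr expR; ring. Qed.

Lemma min_wt_ub x y : Num.min (wt x) (wt y) * (h x - h y) <= wt x * (h x - h y).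
Proof.
have [hxy|hxy] := leP (h x) (h y).
  rewrite (min_idPl _) // ler_expR ler_wpM2l //.
by rewrite ler_wpM2r ?ge_min ?lexx // subr_ge0 ltW.
Qed.

(** A downward move by z is rejected with probability 1 - e^(-D z) <= D z, which costs at most D z^2
    in the drift. *)
Lemma min_wt_lb x y : wt x * (h x - h y - D * Num.max 0 (h x - h y) ^+ 2) <=
  Num.min (wt x) (wt y) * (h x - h y).
Proof.
have w0 := wt_gt0 h D x.
have [hxy|hxy] := leP (h x) (h y).
  have wxy : wt x <= wt y by rewrite ler_expR ler_wpM2l.
  by rewrite (min_idPl wxy) max_l ?subr_le0 // expr0n mulr0 subr0.
have wyx : wt y <= wt x by rewrite ler_expR ler_wpM2l // ltW.
rewrite (min_idPr wyx) max_r ?subr_ge0 ?(ltW hxy) //.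
rewrite (wtD x y) -mulrA ler_pM2l //.
have z0 : 0 <= h x - h y by rewrite subr_ge0 ltW.
have := ler_wpM2r z0 (expR_ge1Dx (D * (h y - h x))); lra.
Qed.

Lemma drift_upper x : h x <= r ^+ 2 * N%:R -> drift h K D x <= 2 * r ^+ 2 * wt x.
Proof.
move=> hx; have w0 := wt_gt0 h D x.
have : drift h K D x <= wt x * \sum_y K x y * (h x - h y).
  rewrite mulr_sumr; apply: ler_sum => y _.
  have := ler_wpM2l (Koff_ge0 x y) (min_wt_ub x y); rewrite /cond; lra.
move=> /le_trans; apply.
have -> : \sum_y K x y * (h x - h y) = - (\sum_y K x y * (h y - h x)).
  by rewrite -sumrN; apply: eq_bigr => y _; ring.
rewrite mean_jump // mulrC ler_wpM2r ?(ltW w0) //.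
have : h x / N%:R <= r ^+ 2 by rewrite ler_pdivrMr.
have : 0 <= (2 * N%:R)^-1 :> R by rewrite invr_ge0 mulr_ge0.
have := sqr_ge0 r; lra.
Qed.

(** The entropic pull of [mean_jump] minus the rejections estimated by [down_jump2], with
    [D <= beta]; the 7r dominates 3 * 9/4 * r. *)
Lemma drift_lower x : h x <= r ^+ 2 * N%:R ->
  wt x * ((3 - beta) / 2 - 7 * r) * (h x / N%:R) - wt x * (2 * N%:R)^-1 <= drift h K D x.
Proof.
move=> hx; have w0 := wt_gt0 h D x.
have hN : 0 <= h x / N%:R by rewrite divr_ge0 ?(ltW N0) ?excess_ge0.
have occr a : occ x a <= (1 / 3 + 3 / 2 * r) * N%:R.
  have := occ_near N_gt0 a r_ge0 hx; rewrite ler_norml => /andP[_]; lra.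
have : wt x * (\sum_y K x y * (h x - h y)
    - D * \sum_y K x y * Num.max 0 (h x - h y) ^+ 2) <= drift h K D x.
  rewrite mulr_sumr -sumrN -big_split mulr_sumr /=; apply: ler_sum => y _.
  have := ler_wpM2l (Koff_ge0 x y) (min_wt_lb x y); rewrite /cond; lra.
apply: le_trans.
have -> : \sum_y K x y * (h x - h y) = - (\sum_y K x y * (h y - h x)).
  by rewrite -sumrN; apply: eq_bigr => y _; ring.
rewrite mean_jump // -mulrA -mulrBr ler_pM2l //.
have := ler_wpM2l D_ge0 (down_jump2 N_gt0 occr).
have : D * ((1 / 2 + 3 / 2 * (3 / 2 * r)) * (h x / N%:R)) <=
    (beta / 2 + 7 * r) * (h x / N%:R).
  have : D * (1 / 2 + 3 / 2 * (3 / 2 * r)) <= beta / 2 + 7 * r.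
    by have := r_ge0; have := D_le; have := beta_lt3; have := D_ge0; nra.
  by move=> /(ler_wpM2r hN); lra.
lra.
Qed.

Notation M := (metropolis beta).

Lemma gibbs_ratio x y : gibbs beta y / gibbs beta x = expR (beta * (H y - H x)) :> R.
Proof.
have Z_gt0 : 0 < @Z R N beta.
  rewrite /Z (bigD1 x) //= ltr_pwDl ?expR_gt0 //.
  by apply: sumr_ge0 => t _; apply: expR_ge0.
rewrite mulrBr expRD expRN /gibbs; field.
by rewrite !gt_eqF ?expR_gt0.
Qed.

Lemma metropolis_offE x y : x != y ->
  metropolis_off beta x y = K x y * Num.min 1 (expR (beta * (h y - h x))).
Proof.
move=> xy; rewrite /metropolis_off gibbs_ratio /Koff (negPf xy).
have -> : h y - h x = H y - H x by rewrite /excess; ring.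
have b0 : 0 <= beta by apply: le_trans D_le.
have [hxy|hxy] := leP (H x) (H y).
  rewrite (min_idPl _) ?mulr1 // -expR0 ler_expR mulr_ge0 // subr_ge0 //.
rewrite (min_idPr _) // -expR0 ler_expR mulr_ge0_le0 // subr_le0 ltW //.
Qed.

Lemma metropolisE x y : x != y ->
  M x y = K x y * Num.min 1 (expR (beta * (h y - h x))).
Proof. by move=> xy; rewrite /metropolis (negPf xy) metropolis_offE. Qed.

Lemma sum_metropolis_off x : \sum_(z | z != x) metropolis_off beta x z <= 2^-1 :> R.
Proof.
rewrite -(Koff_sum1 N_gt0 x) [leLHS]big_mkcond; apply: ler_sum => z _.
case: ifP => [zx|_]; last exact: Koff_ge0.
by rewrite metropolis_offE ?(eq_sym x) // ler_piMr ?Koff_ge0 // ge_min lexx.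
Qed.

Lemma metropolis_ge0 x y : 0 <= M x y :> R.
Proof.
have [->|xy] := eqVneq x y.
  rewrite /metropolis eqxx subr_ge0 (le_trans (sum_metropolis_off y)) //.
  by rewrite invf_le1 // ler1n.
by rewrite metropolisE // mulr_ge0 ?Koff_ge0 // le_min ler01 expR_ge0.
Qed.

Lemma metropolis_sum x : \sum_y M x y = 1 :> R.
Proof.
rewrite (bigD1 x) //= {1}/metropolis eqxx.
rewrite [X in _ + X](eq_bigr (metropolis_off beta x)) ?subrK // => y yx.
by rewrite /metropolis eq_sym (negPf yx).
Qed.

Hypothesis r_le : r <= 1 / 24.

Lemma excess_dist x y : h x <= r ^+ 2 * N%:R \/ h y <= r ^+ 2 * N%:R ->
  K x y != 0 -> `|h x - h y| <= 4 * r.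
Proof.
move=> [hx|hy] Kxy; first exact: edge_jump.
by rewrite distrC; apply: edge_jump; rewrite // Koff_sym.
Qed.

(** On a downward move by z the acceptances at [D] and [beta] differ by the factor e^((beta - D) z).
    As z <= 4r, beta - D <= 3 and r <= 1/24, its inverse is at least 1 - 12r >= 1/2. *)
Lemma metropolis_cond x y : h x <= r ^+ 2 * N%:R \/ h y <= r ^+ 2 * N%:R -> x != y ->
  cond h K D x y <= 2 * (wt x * M x y).
Proof.
move=> hxy xy; rewrite metropolisE // /cond; have w0 := wt_gt0 h D x.
have [->|Kxy] := eqVneq (K x y) 0; first by rewrite !mul0r !mulr0.
have := excess_dist hxy Kxy; rewrite ler_norml => /andP[e1 e2].
suff : Num.min (wt x) (wt y) <= 2 * (wt x * Num.min 1 (expR (beta * (h y - h x)))).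
  by move=> /(ler_wpM2l (Koff_ge0 x y)); lra.
have [up|down] := leP (h x) (h y).
  rewrite (@min_l _ _ 1) ?ge_min; last first.
    rewrite -expR0 ler_expR mulr_ge0 ?subr_ge0 //; exact: le_trans D_le.
  by apply/orP; left; lra.
rewrite (@min_r _ _ 1); last first.
  by rewrite -expR0 ler_expR mulr_ge0_le0 ?subr_le0 ?(ltW down) //; apply: le_trans D_le.
rewrite ge_min; apply/orP; right; rewrite (wtD x y) mulrCA ler_wpM2l ?(ltW w0) //.
have -> : beta * (h y - h x) = D * (h y - h x) + (beta - D) * (h y - h x) by ring.
rewrite expRD mulrCA ler_peMr ?expR_ge0 //.
have := expR_ge1Dx ((beta - D) * (h y - h x)).
have : (beta - D) * (h x - h y) <= 3 * (4 * r).
  have := D_le; have := D_ge0; have := beta_lt3 => b3 D0 Db.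
  by apply: ler_pM; rewrite ?subr_ge0 ?(ltW down) //; lra.
have := r_le; lra.
Qed.

(** To first order the detailed-balance defect of a pair is (beta - D)(h y - h x) times the
    proposal. Its mean is a multiple of [mean_jump] and at most of order r^2 rather than r; the
    second-order remainder is at most (12 r)^2, since jumps are at most 4r and beta - D <= 3. *)
Lemma wt_metropolis y : h y <= r ^+ 2 * N%:R ->
  \sum_x wt x * M x y <= (1 + 80 * r ^+ 2) * wt y.
Proof.
move=> hy; have w0 := wt_gt0 h D y.
have key x : x != y -> wt x * M x y - wt y * M y x <=
   wt y * (K y x * ((beta - D) * (h y - h x) + 144 * r ^+ 2)).
  move=> xy; rewrite metropolisE // metropolisE 1?eq_sym // (Koff_sym x).
  have [->|Kyx] := eqVneq (K y x) 0; first by rewrite !(mul0r, mulr0) subrr.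
  have := excess_dist (or_introl hy) Kyx; rewrite ler_norml => /andP[e1 e2].
  suff : expR (D * (h x - h y)) * Num.min 1 (expR (beta * (h y - h x)))
      - Num.min 1 (expR (beta * (h x - h y))) <=
      (beta - D) * (h y - h x) + 144 * r ^+ 2.
    move=> /(ler_wpM2l (Koff_ge0 y x))/(ler_wpM2l (ltW w0)).
    rewrite (wtD y x); lra.
  have b0 : 0 <= beta by apply: le_trans D_le.
  have g0 : 0 <= beta - D by rewrite subr_ge0.
  have [up|down] := leP (h y) (h x).
    rewrite (@min_r _ _ 1); last by rewrite -expR0 ler_expR mulr_ge0_le0 ?subr_le0.
    rewrite (@min_l _ _ 1); last by rewrite -expR0 ler_expR mulr_ge0 ?subr_ge0.
    rewrite -expRD.
    set z := (beta - D) * (h x - h y).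
    have -> : D * (h x - h y) + beta * (h y - h x) = - z by rewrite /z; ring.
    have z0 : 0 <= z by rewrite mulr_ge0 // subr_ge0.
    have z1 : z <= 3 * (4 * r).
      have := D_ge0; have := beta_lt3 => b3 D0.
      by apply: ler_pM; rewrite ?subr_ge0 //; lra.
    have : expR (- z) <= (1 + z)^-1.
      rewrite expRN lef_pV2 ?posrE ?expR_gt0 ?expR_ge1Dx //; lra.
    have : (1 + z)^-1 <= 1 - z + z ^+ 2.
      rewrite -[leLHS]mul1r ler_pdivrMr; last by lra.
      have : 0 <= z ^+ 3 by rewrite exprn_ge0.
      lra.
    have : z ^+ 2 <= 144 * r ^+ 2.
      have -> : 144 * r ^+ 2 = (3 * (4 * r)) ^+ 2 by ring.
      by rewrite ler_pXn2r // ?nnegrE // (le_trans z0).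
    rewrite /z; lra.
  rewrite (@min_l _ _ 1); last by rewrite -expR0 ler_expR mulr_ge0 ?subr_ge0 ?(ltW down).
  rewrite (@min_r _ _ 1); last first.
    by rewrite -expR0 ler_expR mulr_ge0_le0 ?subr_le0 ?(ltW down).
  set z := (beta - D) * (h y - h x).
  have z0 : 0 <= z by rewrite mulr_ge0 // subr_ge0 ltW.
  have -> : beta * (h x - h y) = D * (h x - h y) + - z by rewrite /z; ring.
  have e1' : expR (D * (h x - h y)) <= 1.
    by rewrite -[leRHS]expR0 ler_expR mulr_ge0_le0 ?subr_le0 ?(ltW down).
  have : expR (D * (h x - h y)) * (1 - expR (- z)) <= 1 * z.
    apply: ler_pM => //.
      by rewrite subr_ge0 -expR0 ler_expR oppr_le0.
    by have := expR_ge1Dx (- z); lra.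
  rewrite expRD; have := sqr_ge0 r; lra.
have split1 : \sum_x wt x * M x y = wt y + \sum_(x | x != y) (wt x * M x y - wt y * M y x).
  rewrite big_split /= sumrN -mulr_sumr.
  have := metropolis_sum y; rewrite (bigD1 y) //= => s1.
  rewrite (bigD1 y) //=; have -> : M y y = 1 - \sum_(i | i != y) M y i by lra.
  ring.
have le1 : \sum_(x | x != y) (wt x * M x y - wt y * M y x) <=
    \sum_x wt y * (K y x * ((beta - D) * (h y - h x) + 144 * r ^+ 2)).
  rewrite [leLHS]big_mkcond; apply: ler_sum => x _.
  case: ifP => [/key//|/negbFE/eqP->]; by rewrite /Koff eqxx mul0r mulr0.
(* 144/2 from the proposal mass 1/2, plus 3 * 3/2 from the linear term, is below 80. *)
rewrite split1; apply: (@le_trans _ _ (wt y + wt y * (80 * r ^+ 2))); last by lra.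
rewrite lerD2l (le_trans le1) // -mulr_sumr ler_pM2l //.
have -> : \sum_x K y x * ((beta - D) * (h y - h x) + 144 * r ^+ 2) =
    - (beta - D) * (\sum_x K y x * (h x - h y)) + 144 * r ^+ 2 * \sum_x K y x.
  by rewrite !mulr_sumr -big_split; apply: eq_bigr => x _ /=; ring.
rewrite mean_jump // Koff_sum1 //.
have hN : h y / N%:R <= r ^+ 2 by rewrite ler_pdivrMr.
have hN0 : 0 <= h y / N%:R by rewrite divr_ge0 ?(ltW N0) ?excess_ge0.
have N2 : 0 <= (2 * N%:R)^-1 :> R by rewrite invr_ge0 mulr_ge0.
have := D_le; have := D_ge0; have := beta_lt3 => b3 D0 Db.
have h1 : (beta - D) * (h y / N%:R) <= 3 * r ^+ 2 by apply: ler_pM => //; lra.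
have h2 : 0 <= (beta - D) * (2 * N%:R)^-1 by rewrite mulr_ge0 // subr_ge0.
have := sqr_ge0 r; lra.
Qed.

End MetropolisDynamics.

(** * Projection of equi-energy sampling on its last coordinate *)

Section KernelAction.
Context {R : realType} {T : finType}.
Implicit Types (L : T -> T -> R) (F : T -> R).

Definition kact L F x : R := \sum_y L x y * F y.

Lemma kact_kmul L L' F : kact (kmul L L') F = kact L (kact L' F).
Proof.
apply/funext => x; rewrite /kact /kmul; under eq_bigr do rewrite mulr_suml.
rewrite exchange_big; apply: eq_bigr => y _; rewrite mulr_sumr.
by apply: eq_bigr => z _; rewrite mulrA.
Qed.

Lemma kact_kpow L F t : kact (kpow L t) F = iter t (kact L) F.
Proof.
elim: t => [|t IH]; last by rewrite iterS -IH -kact_kmul.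
apply/funext => x; rewrite /kact /= /kid (bigD1 x) //= eqxx mul1r big1 ?addr0 // => y.
by rewrite eq_sym => /negPf->; rewrite mul0r.
Qed.

End KernelAction.

Section BandIndex.
Context {R : realType} (N M : nat) (w : R).
Hypotheses (N_gt0 : (0 < N)%N) (w_gt0 : 0 < w) (Mw : M%:R * w = N%:R / 3).
Implicit Types (s t : Omega N) (b : nat -> R).

Notation h := (@excess R N).

(** The default 0 marks states in no band; by [bidxP] they obey the same inequality, which forces
    their excess to vanish. *)
Definition bidx s : nat :=
  if [pick k : 'I_M.+1 | (0 < k)%N && (s \in @band R N M k)] is Some k then k else 0%N.

Let M_gt0 : 0 < M%:R :> R.
Proof.
rewrite lt0r ler0n andbT; apply/eqP => M0.
have : 0 < N%:R / 3 :> R by rewrite divr_gt0 ?ltr0n.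
by rewrite -Mw M0 mul0r ltxx.
Qed.

Lemma energy_levelE k : energy_level N M k = N%:R / 6 + k%:R * w :> R.
Proof.
rewrite /energy_level; congr (_ + _).
have -> : N%:R = 3 * (M%:R * w) by rewrite Mw; field.
by field; rewrite gt_eqF.
Qed.

Lemma mem_band k s : (0 < k)%N ->
  (s \in @band R N M k) = (k%:R * w - w < h s <= k%:R * w).
Proof.
case: k => // k _; rewrite inE !energy_levelE /= /excess -natr1.
by congr andb; apply/idP/idP; lra.
Qed.

Lemma H_le s : H s <= N%:R / 2 :> R.
Proof.
have N0 : 0 < N%:R :> R by rewrite ltr0n.
have : \sum_(i < N) \sum_(k < N) (s i == s k)%:R <= N%:R * N%:R :> R.
  have row i : \sum_(k < N) (s i == s k)%:R <= N%:R :> R.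
    apply: (@le_trans _ _ (\sum_(k < N) (1 : R))).
      by apply: ler_sum => k _; case: eqP.
    by rewrite sumr_const card_ord.
  apply: (@le_trans _ _ (\sum_(i < N) (N%:R : R))); first exact: ler_sum.
  by rewrite sumr_const card_ord -[leLHS]mulr_natr.
move=> le; rewrite /H ler_pdivrMl ?mulr_gt0 //; lra.
Qed.

Lemma bidxP s : (bidx s)%:R * w - w < h s <= (bidx s)%:R * w.
Proof.
rewrite /bidx; case: pickP => [k /andP[k0]|none]; first by rewrite mem_band.
rewrite mul0r sub0r; suff : h s <= 0.
  by move=> ->; rewrite (lt_le_trans _ (excess_ge0 N_gt0 s)) ?oppr_lt0.
rewrite leNgt; apply/negP => hs.
have hM : h s <= M%:R * w by rewrite Mw /excess; have := H_le s; lra.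
(* The least n with h <= n w is the index of the band; it does not exceed M because H <= N/2. *)
have ex : exists n, h s <= n%:R * w by exists M.
case: (ex_minnP ex) => n hn minn.
have n0 : (0 < n)%N by case: n hn {minn} => // hn; move: hs; rewrite ltNge -(mul0r w) hn.
have nM : (n < M.+1)%N by rewrite ltnS minn.
have := none (Ordinal nM); rewrite /= n0 mem_band // hn andbT /= => /negbT.
rewrite -leNgt -{2}[w]mul1r -mulrBl => hn1.
case: n n0 {hn nM} minn hn1 => // n _ minn.
by rewrite -natr1 addrK => /minn; rewrite ltnn.
Qed.

Lemma mem_band_bidx k s : (0 < k)%N -> (s \in @band R N M k) = (bidx s == k).
Proof.
move=> k0; rewrite mem_band //; apply/idP/eqP => [/andP[k1 k2]|<-]; last exact: bidxP.
have /andP[j1 j2] := bidxP s.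
have lt_bound m n : m%:R * w - w < n%:R * w -> (m <= n)%N.
  move=> mn; rewrite -ltnS -(ltr_nat R) -natr1 -(ltr_pM2r w_gt0) mulrDl mul1r; lra.
by apply/eqP; rewrite eqn_leq !lt_bound //; lra.
Qed.

Variable b : nat -> R.
Variable m : nat.
Notation D := (b m.+1 - b m).
Notation wt := (weight h D).
Notation bcond := (band_cond h bidx D).

(** The partition functions cancel and only the difference of inverse temperatures survives: this is
    why the equi-energy kernel is reversible for e^(D h) inside each band. *)
Lemma gibbs_cross s t : gibbs (b m.+1) t * gibbs (b m) s
  / (gibbs (b m.+1) s * gibbs (b m) t) = wt t / wt s.
Proof.
have Z_gt0 c : 0 < @Z R N c.
  rewrite /Z (bigD1 s) //= ltr_pwDl ?expR_gt0 //.
  by apply: sumr_ge0 => u _; apply: expR_ge0.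
have e1 : expR (b m.+1 * H t) * expR (b m * H s) * wt s =
    wt t * (expR (b m.+1 * H s) * expR (b m * H t)).
  by rewrite /weight -!expRD; congr expR; rewrite /excess; ring.
have -> : wt t = expR (b m.+1 * H t) * expR (b m * H s) * wt s
    / (expR (b m.+1 * H s) * expR (b m * H t)).
  by rewrite e1; field; rewrite !gt_eqF ?expR_gt0.
by rewrite /gibbs; field; rewrite !gt_eqF ?wt_gt0 ?expR_gt0.
Qed.

Lemma equi_energy_offE s t : equi_energy_off M b m.+1 s t = (wt s)^-1 * bcond s t.
Proof.
rewrite /equi_energy_off /band_cond.
have -> : [pick k : 'I_M.+1 | (0 < k)%N && (s \in @band R N M k)] =
    if (0 < bidx s)%N then Some (inord (bidx s)) else None.
  rewrite /bidx; case: pickP => [k|//]; case/andP => k0 _.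
  by rewrite k0 inord_val.
have [s0|s0] := ltnP 0 (bidx s); last by rewrite andbF mulr0.
have sM : (bidx s < M.+1)%N by rewrite /bidx; case: pickP.
rewrite inordK // andbT mem_band_bidx // gibbs_cross.
have -> : #|@band R N M (bidx s)|%:R = band_size bidx s :> R.
  by congr _%:R; apply: eq_card => u; rewrite mem_band_bidx // inE.
rewrite eq_sym; case: eqP => _; last by rewrite !mulr0.
rewrite mulr1 -(@mulfK _ (wt s) _ (Num.min _ _)) ?gt_eqF ?wt_gt0 //.
rewrite minr_pMl ?(ltW (wt_gt0 _ _ _)) // mul1r divfK ?gt_eqF ?wt_gt0 //.
ring.
Qed.

Lemma kact_equi_energy F s :
  kact (equi_energy M b m.+1) F s = F s - gen wt bcond F s.
Proof.
rewrite /kact /gen mulr_sumr.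
have -> : \sum_y (wt s)^-1 * (bcond s y * (F s - F y)) =
    \sum_(y | y != s) equi_energy_off M b m.+1 s y * (F s - F y).
  rewrite [RHS]big_mkcond; apply: eq_bigr => y _; rewrite equi_energy_offE.
  by case: eqP => [->|_]; rewrite ?subrr ?mulr0 ?mulrA.
rewrite (bigD1 s) //= {1}/equi_energy /= eqxx.
rewrite [X in _ + X = _](eq_bigr (fun y => equi_energy_off M b m.+1 s y * F y)); last first.
  by move=> y ys; rewrite /equi_energy (eq_sym s) (negPf ys).
have -> : \sum_(y | y != s) equi_energy_off M b m.+1 s y * (F s - F y) =
    (\sum_(y | y != s) equi_energy_off M b m.+1 s y) * F s
    - \sum_(y | y != s) equi_energy_off M b m.+1 s y * F y.
  by rewrite mulr_suml -sumrN -big_split; apply: eq_bigr => y _ /=; ring.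
ring.
Qed.

End BandIndex.

Section LastCoordinate.
Context {R : realType} (N M : nat) (w : R) (b : nat -> R).
Hypotheses (N_gt0 : (0 < N)%N) (w_gt0 : 0 < w).
Hypothesis Mw : M.+1%:R * w = N%:R / 3.
Implicit Types (F : Omega N -> R) (x y : EESstate N M.+1).

Definition at_last F (x : EESstate N M.+1) : R := F (x ord_max).

Lemma on_coordE i (L : Omega N -> Omega N -> R) x y :
  on_coord i L x y = \sum_s L (x i) s * (y == [ffun k => if k == i then s else x k])%:R.
Proof.
rewrite (bigD1 (y i)) //= big1 ?addr0; last first.
  move=> s /negPf sy; case: eqP => [e|_]; last by rewrite mulr0.
  by move: sy; rewrite e ffunE eqxx eqxx.
rewrite /on_coord; have -> : [forall j, (j != i) ==> (x j == y j)] =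
    (y == [ffun k => if k == i then y i else x k]).
  apply/forallP/eqP => [a|e k].
    apply/ffunP => k; rewrite ffunE; have [->//|ki] := eqVneq k i.
    by have := a k; rewrite ki => /eqP.
  by apply/implyP => ki; rewrite e ffunE (negPf ki).
by case: eqP => _; rewrite ?mulr1 ?mulr0.
Qed.

Lemma kact_on_coord i (L : Omega N -> Omega N -> R) F :
  (forall s, \sum_t L s t = 1) ->
  kact (on_coord i L) (at_last F) = at_last (if i == ord_max then kact L F else F).
Proof.
move=> L1; apply/funext => x; rewrite /kact.
under eq_bigr do rewrite on_coordE mulr_suml.
rewrite exchange_big /=.
have row s : \sum_y L (x i) s * (y == [ffun k => if k == i then s else x k])%:R *
    at_last F y = L (x i) s * F (if ord_max == i then s else x ord_max).
  under eq_bigr do rewrite -mulrA.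
  rewrite -mulr_sumr; congr (_ * _).
  rewrite (bigD1 [ffun k => if k == i then s else x k]) //= eqxx mul1r big1 ?addr0.
    by rewrite /at_last ffunE.
  by move=> y /negPf->; rewrite mul0r.
under eq_bigr do rewrite row.
rewrite /at_last eq_sym; case: eqP => [<-//|_].
by rewrite -mulr_suml L1 mul1r.
Qed.

Notation h := (@excess R N).
Notation bidx := (@bidx R N M.+1).
Notation D := (b M.+1 - b M).
Notation wt := (weight h D).
Notation bcond := (band_cond h bidx D).
Notation p := (M.+2%:R^-1 : R).

Lemma equi_energy_sum i (s : Omega N) : \sum_t equi_energy M.+1 b i s t = 1.
Proof.
have -> : \sum_t equi_energy M.+1 b i s t = kact (equi_energy M.+1 b i) (fun=> 1) s.
  by apply: eq_bigr => t _; rewrite mulr1.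
rewrite /kact (bigD1 s) //= mulr1 {1}/equi_energy.
case: (altP eqP) => [->|i0].
  rewrite /kid eqxx big1 ?addr0 // => t ts.
  by rewrite /equi_energy eqxx /kid eq_sym (negPf ts) mul0r.
rewrite eqxx -[RHS](subrK (\sum_(u | u != s) equi_energy_off M.+1 b i s u)).
congr (_ + _); apply: eq_bigr => t ts.
by rewrite mulr1 /equi_energy (negPf i0) eq_sym (negPf ts).
Qed.

(** Only the last of the M+2 coordinates sees [at_last F]; kernels on the others have unit row sums
    and act as the identity. *)
Lemma sum_on_coord (L : nat -> Omega N -> Omega N -> R) F :
  (forall i s, \sum_t L i s t = 1) ->
  \sum_(i < M.+2) kact (on_coord i (L i)) (at_last F) =
    (fun x => M.+2%:R * at_last (fun s => (1 - p) * F s + p * kact (L M.+1) F s) x).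
Proof.
move=> L1; apply/funext => x; rewrite fct_sumE.
rewrite (bigD1 ord_max) //= kact_on_coord // eqxx.
rewrite (eq_bigr (fun=> at_last F x)); last first.
  by move=> i /negPf im; rewrite kact_on_coord // im.
rewrite sumr_const; have := cardC1 (@ord_max M.+1); rewrite card_ord /= => ->.
have -> : at_last F x *+ M.+1 = M.+2%:R * at_last F x - at_last F x.
  by rewrite [X in _ = X - _]mulr_natl [X in _ = X - _]mulrSr addrK.
have : M.+2%:R != 0 :> R by rewrite pnatr_eq0.
by rewrite /at_last; move: (M.+2%:R : R) => c c0; field.
Qed.

(** Each factor preserves observables of the last coordinate, so the triple average factors into
    three averages, each lazy with p = 1/(M+2). *)
Lemma kact_EES F : kact (EES N M.+1 b) (at_last F) =
  at_last (chain h bidx D (metropolis (b M.+1)) p F).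
Proof.
have kact_sum L (G : 'I_M.+2 -> EESstate N M.+1 -> R) :
    \sum_k kact L (G k) = kact L (\sum_k G k).
  apply/funext => x; rewrite fct_sumE /kact exchange_big; apply: eq_bigr => y _ /=.
  by rewrite fct_sumE mulr_sumr.
have kactZ L a (G : EESstate N M.+1 -> R) : kact L (fun x => a * G x) = (fun x => a * kact L G x).
  apply/funext => x; rewrite /kact mulr_sumr; apply: eq_bigr => y _; ring.
have sumZ a (G : 'I_M.+2 -> EESstate N M.+1 -> R) :
    \sum_k (fun x => a * G k x) = (fun x => a * (\sum_k G k) x).
  by apply/funext => x; rewrite !fct_sumE mulr_sumr.
have lzE G : (fun s => (1 - p) * G s + p * kact (equi_energy M.+1 b M.+1) G s) =
    lazy wt bcond p G.
  apply/funext => s; rewrite (kact_equi_energy N_gt0 w_gt0 Mw) /lazy; ring.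
pose S := \sum_(j < M.+2) \sum_(k < M.+2) \sum_(l < M.+2)
  kact (Qlift b j) (kact (Tlift b k) (kact (Qlift b l) (at_last F))).
have -> : kact (EES N M.+1 b) (at_last F) = (fun x => (M.+2%:R ^+ 3)^-1 * S x).
  apply/funext => x; rewrite /kact /EES /S fct_sumE.
  under eq_bigr do rewrite -mulrA.
  rewrite -mulr_sumr; congr (_ * _).
  under eq_bigr do rewrite mulr_suml.
  rewrite exchange_big; apply: eq_bigr => j _ /=; rewrite fct_sumE.
  under eq_bigr do rewrite mulr_suml.
  rewrite exchange_big; apply: eq_bigr => k _ /=; rewrite fct_sumE.
  under eq_bigr do rewrite mulr_suml.
  rewrite exchange_big; apply: eq_bigr => l _ /=.
  by rewrite -!kact_kmul.
have metE := @metropolis_sum R N.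
have -> : S = (fun x => M.+2%:R ^+ 3 * at_last (chain h bidx D (metropolis (b M.+1)) p F) x).
  have -> : S = \sum_j kact (Qlift b j) (\sum_k kact (Tlift b k)
      (\sum_l kact (Qlift b l) (at_last F))).
    apply: eq_bigr => j _; rewrite -kact_sum; apply: eq_bigr => k _.
    by rewrite -!kact_sum.
  rewrite (sum_on_coord F equi_energy_sum) lzE.
  under eq_bigr do under eq_bigr do rewrite kactZ.
  rewrite sumZ (sum_on_coord _ (fun i => metE (b i))).
  under eq_bigr do rewrite kactZ kactZ.
  rewrite !sumZ (sum_on_coord _ equi_energy_sum) lzE.
  by apply/funext => x; rewrite [in RHS]exprS expr2 -!mulrA.
by apply/funext => x; rewrite mulrA mulVf ?mul1r // expf_neq0 // pnatr_eq0.
Qed.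

End LastCoordinate.

(** * Partition functions and symmetry *)

Section PartitionFunctions.
Context {R : realType} {N : nat}.
Hypothesis N_gt0 : (0 < N)%N.
Implicit Types (x y : Omega N).

Notation h := (@excess R N).
Notation K := (@Koff R N).

Let N0 : 0 < N%:R :> R. Proof. by rewrite ltr0n. Qed.

Lemma card_Omega : \sum_(x : Omega N) 1 = 3 ^+ N :> R.
Proof. by rewrite sumr_const card_ffun !card_ord natrX. Qed.

(* The mean drift of h under the uniform measure vanishes. *)
Lemma mean_excess : \sum_x h x = 3 ^+ N / 3.
Proof.
have s0 : \sum_x \sum_y K x y * (h y - h x) = 0.
  apply/eqP; rewrite -[_ == 0](mulrn_eq0 _ 2) mulr2n {2}exchange_big -big_split /=.
  apply/eqP; apply: big1 => x _; rewrite -big_split; apply: big1 => y _ /=.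
  by rewrite (Koff_sym y); ring.
move: s0; under eq_bigr do rewrite mean_jump // -[_^-1]mulr1.
rewrite big_split /= sumrN -!mulr_sumr -mulr_suml card_Omega => e.
have -> : \sum_x h x = 2 / 3 * N%:R * (3 / 2 * ((\sum_i h i) / N%:R)).
  by field; rewrite gt_eqF.
have -> : 3 / 2 * ((\sum_i h i) / N%:R) = (2 * N%:R)^-1 * 3 ^+ N by lra.
by field; rewrite gt_eqF.
Qed.

(** Markov's inequality, as the excess has mean 1/3 under the uniform measure. *)
Lemma low_excess_mass : 2 / 3 * 3 ^+ N <= \sum_(x | h x <= 1) (1 : R).
Proof.
have -> : 2 / 3 * 3 ^+ N = \sum_x (1 - h x).
  by rewrite big_split /= sumrN mean_excess card_Omega; field.
rewrite [leRHS]big_mkcond; apply: ler_sum => x _.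
have h0 : 0 <= h x by exact: excess_ge0.
by have [hx|hx] /= := leP (h x) 1; lra.
Qed.

(* Summed over a sublevel set of h, the drift is a flux through its boundary, hence
   nonpositive; as the drift is at least (c h - 1/2) / N, most of the weight sits
   at h <= 1 / c. *)
Lemma partition_low (D r c : R) : 0 <= D -> D < 3 -> 0 <= r -> N%:R^-1 <= r ->
    0 < c -> c <= (3 - D) / 2 - 7 * r ->
  \sum_(x | h x <= r ^+ 2 * N%:R) expR (D * h x) <= 2 * expR (D / c) * 3 ^+ N.
Proof.
move=> D0 D3 r0 Nr c0 cr.
set S := fun x => h x <= r ^+ 2 * N%:R; set W := \sum_(x | _) _.
have W0 : 0 <= W by apply: sumr_ge0 => x _; apply: expR_ge0.
have flux : \sum_(x | S x) drift h K D x <= 0.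
  rewrite /drift; under eq_bigr do rewrite (bigID S) /=.
  rewrite big_split /=; set A := (X in X + _ <= _).
  have A0 : A = 0.
    apply/eqP; rewrite -[_ == 0](mulrn_eq0 _ 2) mulr2n {2}/A exchange_big -big_split /=.
    apply/eqP; apply: big1 => x _; rewrite -big_split; apply: big1 => y _ /=.
    by rewrite (cond_sym h D (@Koff_sym R N) y); ring.
  rewrite A0 add0r; apply: sumr_le0 => x Sx; apply: sumr_le0 => y Sy.
  rewrite mulr_ge0_le0 ?cond_ge0 //; first exact: Koff_ge0.
  by rewrite subr_le0 (le_trans Sx) // ltW // ltNge.
have drift_ge : \sum_(x | S x) expR (D * h x) * (c * (h x / N%:R) - (2 * N%:R)^-1) <= 0.
  apply: le_trans flux; apply: ler_sum => x Sx.
  have := drift_lower N_gt0 D0 (lexx D) D3 r0 Sx.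
  have : expR (D * h x) * c * (h x / N%:R) <=
      expR (D * h x) * ((3 - D) / 2 - 7 * r) * (h x / N%:R).
    rewrite ler_wpM2r ?divr_ge0 ?excess_ge0 ?(ltW N0) // ler_wpM2l ?expR_ge0 //.
  by rewrite /weight; lra.
have low : W / 2 <= \sum_(x | h x <= c^-1) expR (D * h x).
  have : \sum_(x | S x) expR (D * h x) * (c * h x - 2^-1) <= 0.
    have := ler_wpM2l (ltW N0) drift_ge; rewrite mulr0 => le0.
    apply: le_trans le0; rewrite mulr_sumr; apply: ler_sum => x _.
    rewrite le_eqVlt; apply/orP; left; apply/eqP; field; rewrite gt_eqF //.
  have : \sum_(x | S x) (expR (D * h x) / 2 - expR (D * h x) * (c * h x - 2^-1)) <=
      \sum_(x | h x <= c^-1) expR (D * h x).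
    rewrite [leLHS]big_mkcond [leRHS]big_mkcond; apply: ler_sum => x _.
    have e0 := expR_ge0 (D * h x); have ch : 0 <= c * h x.
      by rewrite mulr_ge0 ?excess_ge0 // ltW.
    have [hc|hc] := leP (h x) c^-1.
      case: ifP => // _; have := mulr_ge0 e0 ch; lra.
    have : 1 <= c * h x by rewrite -ler_pdivrMl // mulr1 ltW.
    by case: ifP => // _ h1; have := ler_wpM2l e0 h1; lra.
  rewrite big_split /= sumrN -mulr_suml -/W; lra.
have : \sum_(x | h x <= c^-1) expR (D * h x) <= expR (D / c) * 3 ^+ N.
  rewrite -card_Omega mulr_sumr [leLHS]big_mkcond; apply: ler_sum => x _.
  rewrite mulr1; case: ifP => [hc|_]; last exact: expR_ge0.
  by rewrite ler_expR ler_wpM2l.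
lra.
Qed.

(* Completing the square in each occupation number linearizes H; the weights
   are the colour frequencies of the ordered phase at criticality. *)
Lemma Z_ge (beta : R) : 0 <= beta ->
  (expR (- (beta / 12)) * (expR (beta / 2) + 2)) ^+ N <= @Z R N beta.
Proof.
move=> b0; pose l (a : 'I_3) : R := if a == ord0 then 2 / 3 else 6^-1.
have l2 : \sum_a l a ^+ 2 = 2^-1.
  by rewrite !big_ord_recl big_ord0 /l /=; field.
have Hl (x : Omega N) : \sum_a l a * occ x a - N%:R / 4 <= H x.
  rewrite HE ler_pdivlMl ?mulr_gt0 //.
  have -> : 2 * N%:R * (\sum_a l a * occ x a - N%:R / 4) =
      \sum_a (2 * N%:R * (l a * occ x a) - N%:R ^+ 2 * l a ^+ 2).
    by rewrite big_split /= sumrN -!mulr_sumr l2; field.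
  apply: ler_sum => a _; have := sqr_ge0 (occ x a - N%:R * l a); lra.
have -> : (expR (- (beta / 12)) * (expR (beta / 2) + 2)) ^+ N =
    expR (- (beta * (N%:R / 4))) * (\sum_a expR (beta * l a)) ^+ N.
  have -> : \sum_a expR (beta * l a) = expR (beta / 6) * (expR (beta / 2) + 2).
    rewrite !big_ord_recl big_ord0 /l /= addr0 mulrDr -expRD.
    have -> : beta / 6 + beta / 2 = beta * (2 / 3) by field.
    by ring.
  rewrite -[- (beta * (N%:R / 4))](_ : N%:R * (- (beta / 4)) = _); last by ring.
  rewrite expRM_natl -exprMn mulrA -expRD.
  by rewrite (_ : - (beta / 4) + beta / 6 = - (beta / 12)) //; field.
have -> : (\sum_a expR (beta * l a)) ^+ N = \prod_(i < N) \sum_a expR (beta * l a).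
  by rewrite prodr_const card_ord.
rewrite bigA_distr_bigA mulr_sumr.
apply: ler_sum => x _.
have -> : \prod_(i < N) expR (beta * l (x i)) = expR (\sum_a occ x a * (beta * l a)).
  by rewrite -(sum_spin x (fun a => beta * l a)) expR_sum.
rewrite -expRD ler_expR.
apply: le_trans (ler_wpM2l b0 (Hl x)).
have -> : \sum_a occ x a * (beta * l a) = beta * \sum_a l a * occ x a.
  by rewrite mulr_sumr; apply: eq_bigr => a _; ring.
lra.
Qed.

End PartitionFunctions.

Section Factorials.
Context {R : realType}.

(** Here and in [fact_ge], crude Stirling bounds by induction from (1 + 1/n)^n <= e <= (1 +
    1/n)^(n+1); the lost polynomial factors are harmless. *)
Lemma fact_le n : n`!%:R <= n.+1%:R ^+ n.+1 * expR (- n%:R) :> R.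
Proof.
elim: n => [|n IH]; first by rewrite oppr0 expR0 fact0 expr1 mulr1.
have n1 : 0 < n.+1%:R :> R by rewrite ltr0n.
have n2 : 0 < n.+2%:R :> R by rewrite ltr0n.
have base : expR (1 / n.+2%:R) <= n.+2%:R / n.+1%:R :> R.
  have -> : n.+1%:R = n.+2%:R - 1 :> R by rewrite -[n.+2%:R]natr1 addrK.
  move: n2 (expR_ge1Dx (- (1 / n.+2%:R) : R)); rewrite expRN.
  have : 1 < n.+2%:R :> R by rewrite ltr1n.
  move: (n.+2%:R : R) (expR_gt0 (1 / n.+2%:R : R)) => d.
  move: (expR _) => e e0 d1 d0 le.
  rewrite ler_pdivlMr ?subr_gt0 //.
  have -> : e * (d - 1) = e * d * (1 + - (1 / d)) by field; rewrite gt_eqF.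
  apply: le_trans (ler_wpM2l _ le) _; first by rewrite mulr_ge0 ?ltW.
  by rewrite mulrAC mulfV ?mul1r // gt_eqF.
have e1 : expR 1 <= (n.+2%:R / n.+1%:R) ^+ n.+2 :> R.
  have -> : expR 1 = expR (1 / n.+2%:R) ^+ n.+2 :> R.
    by rewrite -expRM_natl; congr expR; field; rewrite gt_eqF.
  by rewrite ler_pXn2r // nnegrE ?expR_ge0 // divr_ge0 ?ltW.
rewrite factS natrM; apply: (@le_trans _ _ (n.+1%:R * (n.+1%:R ^+ n.+1 * expR (- n%:R)))).
  by rewrite ler_pM2l.
have -> : - n%:R = - n.+1%:R + 1 :> R by rewrite -[n.+1%:R]natr1; ring.
rewrite expRD [_ * expR 1]mulrC !mulrA -exprS ler_pM2r ?expR_gt0 //.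
have := ler_wpM2l (exprn_ge0 n.+2 (ltW n1)) e1.
by rewrite expr_div_n mulrCA mulfV ?mulr1 // expf_neq0 // gt_eqF.
Qed.

Lemma fact_ge n : n%:R ^+ n * expR (- n%:R) <= n`!%:R :> R.
Proof.
elim: n => [|n IH]; first by rewrite oppr0 expR0 expr0 mulr1.
have n1 : 0 < n.+1%:R :> R by rewrite ltr0n.
rewrite factS natrM; apply: le_trans (ler_wpM2l (ltW n1) IH).
rewrite exprS -mulrA ler_pM2l // -[in expR (- n.+1%:R)]natr1 opprD expRD mulrA.
rewrite mulrAC ler_pM2r ?expR_gt0 //.
have [->|n0] := posnP n; first by rewrite !expr0 mul1r -[leRHS]expR0 ler_expR oppr_le0.
have np : 0 < n%:R :> R by rewrite ltr0n.
rewrite expRN ler_pdivrMr ?expR_gt0 //.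
have -> : expR 1 = expR (1 / n%:R) ^+ n :> R.
  by rewrite -expRM_natl; congr expR; field; rewrite gt_eqF.
rewrite -exprMn ler_pXn2r ?nnegrE //.
have := ler_wpM2l (ltW np) (expR_ge1Dx (1 / n%:R : R)).
by rewrite mulrDr mulr1 mul1r mulfV ?gt_eqF // natr1.
Qed.

End Factorials.

(** * Pointwise bounds for densities invariant under site permutations *)

Section Permutations.
Context {R : realType} {N : nat}.
Hypothesis N_gt0 : (0 < N)%N.
Implicit Types (x y : Omega N) (s t : {perm 'I_N}).

Notation h := (@excess R N).

Definition permute s x : Omega N := [ffun i => x (s i)].

Definition sym_fun (f : Omega N -> R) : Prop := forall s x, f (permute s x) = f x.

Lemma permuteK s : cancel (permute s) (permute s^-1%g).
Proof. by move=> x; apply/ffunP => i; rewrite !ffunE permKV. Qed.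

Lemma permute_bij s : bijective (permute s).
Proof.
exists (permute s^-1%g); first exact: permuteK.
by move=> x; rewrite -{1}[s]invgK permuteK.
Qed.

Definition colour_class x (a : 'I_3) : {set 'I_N} := [set i | x i == a].

(** A permutation fixing [x] preserves every colour class and is determined by its restrictions to
    them. *)
Lemma card_stabilizer x :
  (#|[set s : {perm 'I_N} | permute s x == x]| <= \prod_a (#|colour_class x a|)`!)%N.
Proof.
pose phi s : {ffun 'I_3 -> {perm 'I_N}} := [ffun a => restr_perm (colour_class x a) s].
set St := [set s | _].
have normSt s a : s \in St -> s \in ('N(colour_class x a | 'P))%g.
  rewrite inE => /eqP/ffunP sx; apply/astabsP => i; rewrite !inE /= /aperm.
  by have := sx i; rewrite ffunE => ->.
have inj : {in St &, injective phi}.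
  move=> s t sS tS /ffunP st; apply/permP => i.
  have := st (x i); rewrite !ffunE => /permP/(_ i).
  by rewrite !restr_permE ?normSt // inE.
rewrite -(card_in_imset inj).
have -> : (\prod_a (#|colour_class x a|)`! =
    #|family (fun a => perm_on (colour_class x a) : pred {perm 'I_N})|)%N.
  rewrite card_family foldrE big_map big_enum /=.
  by apply: eq_bigr => a _; rewrite card_perm.
apply: subset_leq_card; apply/fintype.subsetP => _ /imsetP[s sS ->].
by apply/familyP => a; rewrite ffunE; apply: restr_perm_on.
Qed.

Lemma card_colour_class x a : #|colour_class x a|%:R = occ x a :> R.
Proof.
rewrite /occ -sum1_card natr_sum big_mkcond; apply: eq_bigr => i _.
by rewrite inE; case: eqP.
Qed.

(** If nonempty, the set is carried into the stabilizer by left multiplication with the inverse of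
    one of its elements. *)
Lemma card_transporter x y :
  (#|[set s : {perm 'I_N} | permute s x == y]| <= \prod_a (#|colour_class x a|)`!)%N.
Proof.
have [->|[t]] := set_0Vmem [set s : {perm 'I_N} | permute s x == y].
  by rewrite cards0.
rewrite inE => /eqP ty; apply: leq_trans (card_stabilizer x).
rewrite -(card_imset _ (mulgI t^-1%g)); apply: subset_leq_card.
apply/fintype.subsetP => _ /imsetP[s sy ->]; rewrite inE in sy.
rewrite inE; apply/eqP/ffunP => i; rewrite ffunE permM.
move/eqP/ffunP/(_ (t^-1%g i)): sy; rewrite ffunE => ->.
by rewrite -ty ffunE permKV.
Qed.

Lemma orbit_mass (u : Omega N -> R) x : (forall y, 0 <= u y) -> sym_fun u ->
  N`!%:R * u x <= (\prod_a (#|colour_class x a|)`!)%:R * \sum_y u y.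
Proof.
move=> u0 us.
have -> : N`!%:R * u x = \sum_(s : {perm 'I_N}) u (permute s x).
  under eq_bigr do rewrite us.
  have cp := card_perm [set: 'I_N]; rewrite cardsT card_ord in cp.
  rewrite sumr_const mulr_natl -cp; congr (_ *+ _); apply: eq_card => s.
  by apply/fintype.subsetP => i _; rewrite inE.
rewrite mulr_sumr (partition_big (permute^~ x) predT) //=; apply: ler_sum => y _.
rewrite (eq_bigr (fun=> u y)); last by move=> s /eqP->.
rewrite sumr_const -[leLHS]mulr_natl ler_wpM2r // ler_nat.
by apply: leq_trans (card_transporter x y); rewrite cardsE.
Qed.

(** This bounds the multinomial coefficient from below by 3^N e^(-6h), up to polynomial factors.
    After Stirling, z <= e^(z-1) at z = 3(n_a + 1)/N leaves the exponents n_a (3(n_a + 1)/N - 1),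
    whose sum is exactly 6h + 3. *)
Lemma multinomial_bound x :
  (\prod_a (#|colour_class x a|)`!)%:R * 3 ^+ N <=
    N`!%:R * (N.+1%:R ^+ 3 * expR (6 * h x + 3)) :> R.
Proof.
have N0 : 0 < N%:R :> R by rewrite ltr0n.
pose n a := #|colour_class x a|.
have nE a : (n a)%:R = occ x a :> R by rewrite card_colour_class.
have sum_n : (\sum_a n a = N)%N.
  by apply/eqP; rewrite -(eqr_nat R) natr_sum; under eq_bigr do rewrite nE; rewrite sum_occ.
have n_le a : (n a <= N)%N by rewrite -[in leqRHS]sum_n (bigD1 a) //= leq_addr.
have up : (\prod_a (n a)`!)%:R <=
    N.+1%:R ^+ 3 * expR (- N%:R) * \prod_a (n a).+1%:R ^+ n a :> R.
  rewrite natr_prod.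
  apply: (@le_trans _ _ (\prod_a ((n a).+1%:R ^+ (n a).+1 * expR (- (n a)%:R) : R))).
    by apply: ler_prod => a _; rewrite ler0n fact_le.
  have eE : expR (- N%:R) = \prod_a expR (- (n a)%:R) :> R.
    by rewrite -expR_sum sumrN -natr_sum sum_n.
  have cE : N.+1%:R ^+ 3 = \prod_(a < 3) N.+1%:R :> R.
    by rewrite prodr_const card_ord.
  rewrite eE cE -!big_split /=; apply: ler_prod => a _.
  rewrite mulr_ge0 ?exprn_ge0 ?expR_ge0 //= exprS mulrAC.
  by rewrite ler_wpM2r ?exprn_ge0 // ler_wpM2r ?expR_ge0 // ler_nat ltnS.
have mid : \prod_a (n a).+1%:R ^+ n a * 3 ^+ N <= N%:R ^+ N * expR (6 * h x + 3) :> R.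
  have pE (c : R) : c ^+ N = \prod_a c ^+ n a by rewrite -sum_n expr_sum.
  have -> : expR (6 * h x + 3) =
      \prod_a expR (3 * (n a).+1%:R / N%:R - 1) ^+ n a :> R.
    under eq_bigr do rewrite -expRM_natl.
    rewrite -expR_sum; congr expR.
    have e a : (n a)%:R * (3 * (n a).+1%:R / N%:R - 1) =
        3 / N%:R * occ x a ^+ 2 + (3 / N%:R - 1) * occ x a :> R.
      by rewrite -[(n a).+1%:R]natr1 nE; field; rewrite gt_eqF.
    under eq_bigr do rewrite e.
    rewrite big_split /= -!mulr_sumr sum_occ /excess HE.
    by field; rewrite gt_eqF.
  rewrite !pE -!big_split /=; apply: ler_prod => a _.
  rewrite mulr_ge0 ?exprn_ge0 //= -!exprMn lerXn2r ?nnegrE //.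
  have := ler_wpM2l (ltW N0) (expR_ge1Dx (3 * (n a).+1%:R / N%:R - 1)).
  have -> : N%:R * (1 + (3 * (n a).+1%:R / N%:R - 1)) = (n a).+1%:R * 3 :> R.
    by field; rewrite gt_eqF.
  by [].
have low := fact_ge (R := R) N.
have c0 : 0 <= N.+1%:R ^+ 3 :> R by rewrite exprn_ge0.
have e0 := expR_ge0 (- N%:R : R); have f0 := expR_ge0 (6 * h x + 3).
have up' := ler_wpM2r (exprn_ge0 N (ler0n R 3)) up.
have mid' := ler_wpM2l (mulr_ge0 c0 e0) mid.
have low' := ler_wpM2r (mulr_ge0 c0 f0) low.
by rewrite /n in up' mid'; lra.
Qed.

Lemma sym_bound (u : Omega N -> R) x : (forall y, 0 <= u y) -> sym_fun u ->
  u x <= (\sum_y u y) / 3 ^+ N * (N.+1%:R ^+ 3 * expR (6 * h x + 3)).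
Proof.
move=> u0 us; have := orbit_mass x u0 us.
have S0 : 0 <= \sum_y u y by apply: sumr_ge0.
have F0 : 0 < N`!%:R :> R by rewrite ltr0n fact_gt0.
have T0 : 0 < 3 ^+ N :> R by rewrite exprn_gt0.
have := ler_wpM2l S0 (multinomial_bound x) => mb ob.
rewrite -(ler_pM2l F0) -(ler_pM2r T0).
have -> : N`!%:R * ((\sum_y u y) / 3 ^+ N * (N.+1%:R ^+ 3 * expR (6 * h x + 3))) * 3 ^+ N =
    (\sum_y u y) * (N`!%:R * (N.+1%:R ^+ 3 * expR (6 * h x + 3))).
  by field; rewrite gt_eqF.
apply: le_trans mb.
have := ler_wpM2r (ltW T0) ob; lra.
Qed.

End Permutations.

Section Symmetry.
Context {R : realType} {N : nat}.
Implicit Types (x y : Omega N) (s : {perm 'I_N}).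

Notation h := (@excess R N).
Notation K := (@Koff R N).

Lemma H_permute s x : H (permute s x) = H x :> R.
Proof.
rewrite !HE; congr (_ * _); apply: eq_bigr => a _; congr (_ ^+ 2).
rewrite /occ [RHS](reindex_inj (@perm_inj _ s)) /=.
by apply: eq_bigr => i _; rewrite ffunE.
Qed.

Lemma Kgen_permute s x y : Kgen (permute s x) (permute s y) = Kgen x y :> R.
Proof.
rewrite /Kgen (bij_eq (permute_bij s)).
have -> : #|[pred i | permute s x i != permute s y i]| = #|[pred i | x i != y i]|.
  rewrite -!sum1_card [RHS](reindex_inj (@perm_inj _ s)) /=.
  by apply: eq_bigl => i; rewrite !inE !ffunE.
by [].
Qed.

Lemma metropolis_permute (beta : R) s x y :
  metropolis beta (permute s x) (permute s y) = metropolis beta x y.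
Proof.
have off z z' : metropolis_off beta (permute s z) (permute s z') = metropolis_off beta z z'.
  by rewrite /metropolis_off Kgen_permute /gibbs !H_permute.
rewrite /metropolis (bij_eq (permute_bij s)) off; case: eqP => // _; congr (_ - _).
rewrite (reindex (permute s)) /=; last exact: onW_bij (permute_bij s).
by apply: eq_big => z; rewrite ?(bij_eq (permute_bij s)) // => _; rewrite off.
Qed.

Lemma excess_permute s x : h (permute s x) = h x.
Proof. by rewrite /excess H_permute. Qed.

Lemma bidx_permute M s x : @bidx R N M (permute s x) = @bidx R N M x.
Proof.
rewrite /bidx; congr (if _ is Some k then _ else _); apply: eq_pick => k.
by rewrite !inE H_permute.
Qed.

Lemma sum_permute s (F : Omega N -> R) : \sum_y F y = \sum_y F (permute s y).
Proof. by rewrite (reindex (permute s)) //=; exact: onW_bij (permute_bij s). Qed.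

Variables (M : nat) (beta D p : R) (J : nat).
Notation j := (@bidx R N M).

Lemma lazy_sym f : sym_fun f -> sym_fun (lazy (weight h D) (band_cond h j D) p f).
Proof.
move=> fs s x; rewrite /lazy /gen /weight excess_permute fs; congr (_ - _ * (_ * _)).
rewrite (sum_permute s); apply: eq_bigr => y _; rewrite fs; congr (_ * _).
rewrite /band_cond !bidx_permute /weight !excess_permute; congr (if _ then _ / _ else _).
by rewrite /band_size bidx_permute.
Qed.

Lemma killed_push_sym f : sym_fun f ->
  sym_fun (killed_push h j J D (metropolis beta) p f).
Proof.
move=> fs s x; rewrite /killed_push bidx_permute fs /push /weight excess_permute.
case: ifP => // _; congr (_ + _ * (_ * _)).
rewrite (sum_permute s); apply: eq_bigr => y _.
by rewrite fs excess_permute metropolis_permute.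
Qed.

Lemma inside_sym : sym_fun (inside j J : Omega N -> R).
Proof. by move=> s x; rewrite /inside bidx_permute. Qed.

End Symmetry.

(** * Trapping at low energy *)

Section Trapping.
Context {R : realType} (beta w r : R).
Hypotheses (beta_ge0 : 0 <= beta) (beta_lt3 : beta < 3) (w_gt0 : 0 < w) (r_gt0 : 0 < r).

Definition gap : R := 3 - beta.
(** The level gap/96 of [bottom_level] times one third of the drift coefficient 3/8 * gap; the other
    two thirds leave room for the term 1/(2N). *)
Definition drift_const : R := gap / 96 * (gap / 8).
Definition gap_const : R := coercivity w drift_const (expR (beta * w)).
(** The constant of [partition_low] at the exponent (beta + 3)/2, whose drift coefficient gap/4 - 7r
    is at least gap/8. This exponent exceeds [D] by gap/2, which makes the exit layer exponentially
    light. *)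
Definition low_const : R := 2 * expR ((beta + 3) / 2 / (gap / 8)).
Definition bottom_const : R := coercivity_bottom w drift_const (expR (beta * w)).
(** Of the form 1 + z, so that its square dominates z in [escape_bound]. *)
Definition escape_const : R :=
  1 + 3 / 2 * low_const * (1 + bottom_const * (low_const ^+ 2 * expR (12 * w + 6))).

Lemma gap_gt0 : 0 < gap. Proof. by rewrite subr_gt0. Qed.

Lemma drift_const_gt0 : 0 < drift_const.
Proof. by rewrite mulr_gt0 ?divr_gt0 ?gap_gt0 ?ltr0n. Qed.

Lemma gap_const_gt0 : 0 < gap_const.
Proof.
rewrite divr_gt0 ?mulr_gt0 ?expR_gt0 // lt_min ltr01 divr_gt0 // /hardy_const.
have dc := drift_const_gt0.
by rewrite divr_gt0 // mulr_gt0 // s_gt0.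
Qed.

Lemma bottom_const_ge0 : 0 <= bottom_const.
Proof.
have dc := drift_const_gt0.
have hb : 0 <= hardy_bottom_const w drift_const.
  rewrite /hardy_bottom_const divr_ge0 // mulr_ge0 //; last by rewrite addr_ge0 ?ltW.
  exact/ltW/s_gt0.
by rewrite divr_ge0 // mulr_ge0 // expR_ge0.
Qed.

Lemma low_const_gt0 : 0 < low_const.
Proof. by rewrite mulr_gt0 // expR_gt0. Qed.

Lemma escape_const_gt0 : 0 < escape_const.
Proof.
have b0 := bottom_const_ge0; have l0 := low_const_gt0.
rewrite ltr_pwDl //; apply: mulr_ge0; first by rewrite mulr_ge0 ?(ltW l0).
rewrite addr_ge0 //; apply: mulr_ge0 => //.
by rewrite mulr_ge0 ?sqr_ge0 // expR_ge0.
Qed.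

Hypotheses (r_gap : 56 * r <= gap) (r_w : 8 * r <= w) (r_le : r <= 1 / 24).
Hypothesis r_coer : 80 * r <= gap_const.

Variables (N m : nat) (b : nat -> R).
Hypotheses (N_gt0 : (0 < N)%N) (Mw : m.+1%:R * w = N%:R / 3).
Hypotheses (b_m : b m.+1 = beta) (b_ge0 : 0 <= b m) (b_le : b m <= beta).
Hypotheses (N_big : N%:R^-1 <= drift_const * r ^+ 2) (N_big2 : 3 * w + 1 <= r ^+ 2 * N%:R).
Hypothesis m_big : 6 * m.+2%:R^-1 <= gap_const * r.

Notation h := (@excess R N).
Notation K := (@Koff R N).
Notation j := (@bidx R N m.+1).
Notation D := (b m.+1 - b m).
Notation T := (metropolis (b m.+1)).
Notation p := (m.+2%:R^-1 : R).

Let N0 : 0 < N%:R :> R. Proof. by rewrite ltr0n. Qed.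

Definition last_band : nat := Num.truncn (r ^+ 2 * N%:R / w).

Notation J := last_band.

Definition escape_rate : R :=
  escape_const * N.+1%:R ^+ 3 * expR (- (gap / 16 * (r ^+ 2 * N%:R))).

Lemma last_bandP : J%:R * w <= r ^+ 2 * N%:R < J%:R * w + w.
Proof.
have r2 : 0 <= r ^+ 2 * N%:R / w.
  by rewrite divr_ge0 ?(ltW w_gt0) // mulr_ge0 ?sqr_ge0.
have := truncn_itv r2; rewrite -/J => /andP[t1 t2].
rewrite -ler_pdivlMr // t1 /=; move: t2; rewrite ltr_pdivrMr // -natr1 mulrDl mul1r.
by [].
Qed.

Let D_ge0 : 0 <= D. Proof. by rewrite b_m subr_ge0. Qed.

Let D_le : D <= b m.+1. Proof. by rewrite gerBl. Qed.

Let D_le_beta : D <= beta. Proof. by rewrite -b_m. Qed.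

Let jP x := bidxP N_gt0 w_gt0 Mw x.

Let r2_gt0 : 0 < r ^+ 2. Proof. by rewrite exprn_gt0. Qed.

Let invN_le : N%:R^-1 <= r.
Proof.
apply: (le_trans N_big); rewrite expr2 mulrA ler_piMl ?ltW //.
have := gap_gt0; have := r_le; have := r_gt0; have : gap <= 3 by rewrite gerBl.
rewrite /drift_const; nra.
Qed.

Lemma excess_inside x : (j x <= J)%N -> h x <= r ^+ 2 * N%:R.
Proof.
move=> jx; have /andP[_ hx] := jP x; have /andP[Jr _] := last_bandP.
by apply: (le_trans hx); apply: le_trans Jr; rewrite ler_wpM2r ?(ltW w_gt0) // ler_nat.
Qed.

Lemma inside_low x : h x <= 1 -> (j x <= J)%N.
Proof.
move=> hx; have /andP[jh _] := jP x; have /andP[_ Jr] := last_bandP.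
rewrite -ltnS -(ltr_nat R) -(ltr_pM2r w_gt0) -natr1 mulrDl mul1r.
have := N_big2; have := w_gt0; lra.
Qed.

Lemma partition_inside :
  \sum_(x : Omega N | h x <= r ^+ 2 * N%:R) expR ((beta + 3) / 2 * h x)
    <= low_const * 3 ^+ N.
Proof.
have g0 := gap_gt0; have rg := r_gap; have b0 := beta_ge0; have b3 := beta_lt3.
have r0 := r_gt0; have c0 : 0 < gap / 8 by rewrite divr_gt0.
by apply: partition_low => //; rewrite /gap in rg *; lra.
Qed.

Lemma total_ub : total h j J D <= low_const * 3 ^+ N.
Proof.
apply: le_trans partition_inside.
rewrite /total [leLHS]big_mkcond [leRHS]big_mkcond; apply: ler_sum => x _.
case: ifP => [jx|_]; last by case: ifP => // _; apply: expR_ge0.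
rewrite excess_inside // ler_expR ler_wpM2r ?excess_ge0 //.
have := D_le_beta; have := beta_lt3; lra.
Qed.

Lemma total_lb : 2 / 3 * 3 ^+ N <= total h j J D.
Proof.
apply: (le_trans (low_excess_mass N_gt0)).
rewrite /total [leLHS]big_mkcond [leRHS]big_mkcond; apply: ler_sum => x _.
case: ifP => [hx|_]; last by case: ifP => // _; apply: expR_ge0.
by rewrite inside_low // -expR0 ler_expR mulr_ge0 ?excess_ge0.
Qed.

Definition top_states : pred (Omega N) :=
  fun x => (J%:R * w - 4 * r < h x) && (j x <= J)%N.

Definition top_bound : R := low_const * 3 ^+ N * expR (- (gap / 4 * (r ^+ 2 * N%:R))).

(** Chernoff: trading the exponent [D] for (beta + 3)/2 gains at least gap/2 per unit of excess, and
    the excess is at least r^2 N / 2 in the exit layer. *)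
Lemma top_mass : \sum_x weight h D x * (top_states x)%:R <= top_bound.
Proof.
apply: le_trans (ler_wpM2r (expR_ge0 _) partition_inside).
rewrite mulr_suml [leRHS]big_mkcond; apply: ler_sum => x _.
have [/andP[hx jx]|_] := boolP (top_states x); last first.
  by rewrite mulr0; case: ifP => // _; rewrite mulr_ge0 ?expR_ge0.
rewrite excess_inside // mulr1 -expRD ler_expR.
have /andP[_ Jr] := last_bandP; have rw := r_w; have nb := N_big2; have wp := w_gt0.
have h2 : r ^+ 2 * N%:R / 2 <= h x by lra.
have g2 : gap / 2 <= (beta + 3) / 2 - D.
  by have := D_le_beta; rewrite /gap; lra.
have g0 := gap_gt0.
have : gap / 2 * (r ^+ 2 * N%:R / 2) <= ((beta + 3) / 2 - D) * h x.
  apply: ler_pM => //; first by rewrite divr_ge0 // ltW.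
  by rewrite divr_ge0 // mulr_ge0 // ltW.
lra.
Qed.

Lemma exit_top_states x y : (j x <= J)%N -> (J < j y)%N -> T x y != 0 -> top_states x.
Proof.
move=> jx jy Txy; rewrite /top_states jx andbT.
have xy : x != y by apply: contraTN jy => /eqP <-; rewrite -leqNgt.
have Kxy : K x y != 0.
  by apply: contraNN Txy => /eqP K0; rewrite (metropolisE D_ge0 D_le xy) K0 mul0r.
have := edge_jump N_gt0 (ltW r_gt0) invN_le (excess_inside jx) Kxy.
rewrite ler_norml => /andP[e1 _]; have /andP[hy _] := jP y.
have : J.+1%:R <= (j y)%:R :> R by rewrite ler_nat.
rewrite -natr1 => jj; have := ler_wpM2r (ltW w_gt0) jj; rewrite /= mulrDl mul1r; lra.
Qed.

(** The 96 makes the squared peak grow like e^(12 * gap/96 * r^2 N) = e^(gap/8 * r^2 N), with half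
    the exponent of the decay of [top_bound]. *)
Definition bottom_level : R := gap / 96 * (r ^+ 2 * N%:R).

Definition peak_bound : R :=
  low_const * (N.+1%:R ^+ 3 * expR (6 * (bottom_level + w) + 3)).

Lemma bottom_peak (g : Omega N -> R) : sym_fun g -> (forall x, 0 <= g x) ->
  dotw (weight h D) g (fun=> 1) <= total h j J D ->
  forall x, h x < bottom_level + w -> g x <= peak_bound.
Proof.
move=> gs g0 gm x hx.
pose u y := weight h D y * g y.
have u0 y : 0 <= u y by rewrite mulr_ge0 // ltW // wt_gt0.
have us : sym_fun u by move=> s y; rewrite /u /weight excess_permute gs.
have wt1 : 1 <= weight h D x by rewrite -expR0 ler_expR mulr_ge0 ?excess_ge0.
have gu : g x <= u x by rewrite /u ler_peMl.
apply: (le_trans gu); apply: (le_trans (sym_bound N_gt0 x u0 us)).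
have T0 : 0 < 3 ^+ N :> R by rewrite exprn_gt0.
apply: ler_pM; first by rewrite divr_ge0 ?(ltW T0) // sumr_ge0.
- by rewrite mulr_ge0 ?exprn_ge0 ?expR_ge0.
- rewrite ler_pdivrMr //; apply: le_trans total_ub; apply: le_trans gm.
  by apply: ler_sum => y _; rewrite mulr1.
- by rewrite ler_wpM2l ?exprn_ge0 // ler_expR lerD2r ler_pM2l // ltW.
Qed.

(** With X = e^(-gap/8 * r^2 N), the exit layer weighs X^2 and the squared peak is of order 1/X;
    their product X is the square of the decay in [escape_rate]. *)
Lemma escape_bound :
  top_bound * (1 + bottom_const * peak_bound ^+ 2) <= escape_rate ^+ 2 * total h j J D.
Proof.
have l0 := low_const_gt0; have b0 := bottom_const_ge0; have g0 := gap_gt0.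
pose X := expR (- (gap / 8 * (r ^+ 2 * N%:R))).
pose Y := expR (gap / 8 * (r ^+ 2 * N%:R)).
pose n6 : R := (N.+1%:R ^+ 3) ^+ 2.
have X0 : 0 < X by apply: expR_gt0.
have X1 : X <= 1.
  rewrite -expR0 ler_expR oppr_le0; apply: mulr_ge0; first by rewrite divr_ge0 // ltW.
  by rewrite mulr_ge0 // ltW.
have n61 : 1 <= n6 by rewrite /n6 !exprn_ege1 // ler1n.
have XY : X * Y = 1 by rewrite /X /Y -expRD addNr expR0.
have X2 : expR (- (gap / 4 * (r ^+ 2 * N%:R))) = X ^+ 2.
  by rewrite /X [RHS]expr2 -expRD; congr expR; field.
have E2 : expR (- (gap / 16 * (r ^+ 2 * N%:R))) ^+ 2 = X.
  by rewrite /X [LHS]expr2 -expRD; congr expR; field.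
have P2 : expR (6 * (bottom_level + w) + 3) ^+ 2 = Y * expR (12 * w + 6).
  by rewrite /Y [LHS]expr2 -!expRD; congr expR; rewrite /bottom_level; field.
have pE : peak_bound ^+ 2 = low_const ^+ 2 * expR (12 * w + 6) * n6 * Y.
  by rewrite /peak_bound !exprMn P2 /n6; ring.
have eE : escape_rate ^+ 2 = escape_const ^+ 2 * n6 * X.
  by rewrite /escape_rate !exprMn E2 /n6; ring.

rewrite /top_bound X2 pE eE.
set q := low_const ^+ 2 * expR (12 * w + 6).
have q0 : 0 <= q by rewrite mulr_ge0 ?sqr_ge0 ?expR_ge0.
have ec : 3 / 2 * low_const * (1 + bottom_const * q) <= escape_const ^+ 2.
  have z0 : 0 <= 3 / 2 * low_const * (1 + bottom_const * q).
    by apply: mulr_ge0; [rewrite mulr_ge0 ?(ltW l0) | rewrite addr_ge0 // mulr_ge0].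
  have sq (z : R) : 0 <= z -> z <= (1 + z) ^+ 2 by move=> z1; have := sqr_ge0 z; lra.
  by rewrite /escape_const -/q; apply: sq.
have T0 : 0 < 3 ^+ N :> R by rewrite exprn_gt0.
have step1 : low_const * 3 ^+ N * X ^+ 2 * (1 + bottom_const * (q * n6 * Y)) <=
    low_const * (1 + bottom_const * q) * (n6 * X) * 3 ^+ N.
  have -> : low_const * 3 ^+ N * X ^+ 2 * (1 + bottom_const * (q * n6 * Y)) =
      low_const * 3 ^+ N * (X * X + bottom_const * q * n6 * X * (X * Y)) by ring.
  rewrite XY mulr1.
  have -> : low_const * (1 + bottom_const * q) * (n6 * X) * 3 ^+ N =
      low_const * 3 ^+ N * (n6 * X + bottom_const * q * n6 * X) by ring.
  apply: ler_wpM2l; first by rewrite mulr_ge0 // ltW.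
  by rewrite lerD2r ler_wpM2r ?(ltW X0) //; exact: le_trans n61.
apply: (le_trans step1).
have nX : 0 <= n6 * X by rewrite mulr_ge0 ?(ltW X0) // (le_trans ler01).
have ec0 : 0 <= escape_const ^+ 2 * n6 * X by rewrite -mulrA mulr_ge0 ?sqr_ge0.
have := ler_wpM2l ec0 total_lb.
have := ler_wpM2r (ltW T0) (ler_wpM2r nX ec); lra.
Qed.

(** [survival] bounds an average over the trap; some starting state does at least as well as the
    average. *)
Lemma trapped t : exists x,
  1 - escape_rate * t%:R * (t%:R + 1) <= iter t (chain h j D T p) (inside j J) x.
Proof.
have r0 := r_gt0; have w0 := w_gt0; have g0 := gap_gt0; have rg := r_gap.
have b3 : b m.+1 < 3 by rewrite b_m.
have rw := r_w; have Db := D_le_beta; have D0 := D_ge0; have rl := r_le.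
have dc0 := drift_const_gt0; have gE : gap = 3 - beta by [].
have dc1 : drift_const <= 1.
  by have : gap <= 3; [rewrite gE; have := beta_ge0; lra | rewrite /drift_const; nra].
have Nc : (2 * N%:R)^-1 <= drift_const * r ^+ 2 / 2.
  by rewrite invfM mulrC ler_pM2r.
have drift_lo x : (j x <= J)%N ->
    weight h D x * (3 / 8 * gap * (h x / N%:R) - drift_const * r ^+ 2 / 2) <= drift h K D x.
  move=> jx; have := drift_lower N_gt0 D0 D_le b3 (ltW r0) (excess_inside jx).
  apply: le_trans; have wx := ltW (wt_gt0 h D x).
  have hN : 0 <= h x / N%:R by rewrite divr_ge0 ?excess_ge0 ?(ltW N0).
  have k1 : 3 / 8 * gap <= (3 - b m.+1) / 2 - 7 * r by rewrite b_m; lra.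
  have := ler_wpM2l wx (ler_wpM2r hN k1); have := ler_wpM2l wx Nc; lra.
have sv : total h j J D * (1 - escape_rate * t%:R * (t%:R + 1)) <=
    dotw (weight h D) (inside j J) (iter t (chain h j D T p) (inside j J)).
  refine (@survival R _ h K j J D w r drift_const bottom_level (expR (beta * w)) 80 T
    _ w0 r0 _ _ _ _ D0 dc0 _ _ _ _ _ _ _ _ _ _ _ r_coer _ p _ _ m_big
    top_states _ (@sym_fun R N) peak_bound top_bound escape_rate
    _ _ _ _ _ _ _ top_mass escape_bound t).
  - exact: excess_ge0.
  - exact: Koff_ge0.
  - exact: Koff_sym.
  - by move=> x; rewrite Koff_sum1 // invf_le1 // ler1n.
  - exact: jP.
  - by move=> x y jx; apply: edge_jump; rewrite ?(ltW r0) // excess_inside.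
  - by lra.
  - by move=> x jx; apply: drift_upper => //; apply: excess_inside.
  - move=> x jx; apply: le_trans (drift_lo x jx).
    have wx := wt_gt0 h D x.
    have hN : 0 <= 3 / 8 * gap * (h x / N%:R).
      rewrite mulr_ge0 ?divr_ge0 ?excess_ge0 ?(ltW N0) //.
      by rewrite mulr_ge0 // ltW.
    have := mulr_ge0 (ltW wx) hN; have := mulr_ge0 (ltW wx) (ltW r2_gt0).
    have := ler_wpM2l (mulr_ge0 (ltW wx) (ltW r2_gt0)) dc1; lra.
  - move=> x jx hx; apply: le_trans (drift_lo x jx).
    have wx := wt_gt0 h D x.
    have hN : gap / 96 * r ^+ 2 <= h x / N%:R.
      by rewrite ler_pdivlMr // -[leLHS]mulrA.
    have g38 : 0 <= 3 / 8 * gap by rewrite mulr_ge0 // ltW.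
    have := ler_wpM2l (ltW wx) (ler_wpM2l g38 hN).
    have := mulr_ge0 (ltW wx) (mulr_ge0 (sqr_ge0 gap) (ltW r2_gt0)).
    rewrite /drift_const; lra.
  - by [].
  - by rewrite ler_expR ler_wpM2r // ltW.
  - exact: (metropolis_ge0 N_gt0 D0 D_le).
  - exact: metropolis_sum.
  - move=> x y jxy; apply: (metropolis_cond N_gt0 D0 D_le b3 (ltW r0) invN_le rl).
    by case/orP: jxy => /excess_inside; [left|right].
  - move=> y jy; apply: (wt_metropolis N_gt0 D0 D_le b3 (ltW r0) invN_le) => //.
    exact: excess_inside.
  - by lra.
  - by rewrite invr_ge0.
  - by rewrite lef_pV2 ?posrE // ler_nat.
  - exact: exit_top_states.
  - by move=> f; apply: lazy_sym.
  - by move=> f; apply: killed_push_sym.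
  - exact: inside_sym.
  - exact: bottom_peak.
  - by rewrite mulr_ge0 ?(ltW low_const_gt0) // mulr_ge0 ?exprn_ge0 ?expR_ge0.
  - by rewrite mulr_gt0 ?expR_gt0 // mulr_gt0 ?low_const_gt0 ?exprn_gt0.
  - by rewrite mulr_ge0 ?expR_ge0 // mulr_ge0 ?exprn_ge0 // ltW // escape_const_gt0.
have tot0 : 0 < total h j J D.
  by apply: lt_le_trans total_lb; rewrite mulr_gt0 ?exprn_gt0.
apply: contrapT => no; move: sv; apply/negP; rewrite -ltNge.
set v := 1 - _; set f := iter t _ _.
have lt_v x : f x < v by rewrite ltNge; apply/negP => le; apply: no; exists x.
rewrite [X in X * _](_ : _ = \sum_(x | (j x <= J)%N) weight h D x) // mulr_suml.
have -> : dotw (weight h D) (inside j J) f = \sum_(x | (j x <= J)%N) weight h D x * f x.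
  rewrite [RHS]big_mkcond; apply: eq_bigr => x _; rewrite /inside.
  by case: ifP; rewrite ?mulr1 // mulr0 mul0r.
have [x0 jx0] : exists x0, (j x0 <= J)%N.
  apply: contrapT => none; move: tot0; rewrite /total big_pred0 ?ltxx // => x.
  by apply/negP => jx; apply: none; exists x.
rewrite (bigD1 x0) //= [ltRHS](bigD1 x0) //= ltr_leD //.
  by rewrite ltr_pM2l ?wt_gt0.
by apply: ler_sum => x _; rewrite ler_wpM2l ?(ltW (wt_gt0 _ _ _)) // ltW.
Qed.

End Trapping.

Lemma leq_sum5 (a b c d e n : nat) : (a + b + c + d + e <= n)%N ->
  [/\ (a <= n)%N, (b <= n)%N, (c <= n)%N, (d <= n)%N & (e <= n)%N].
Proof. by move=> le; split; lia. Qed.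

(** * Asymptotics in N, test sets for total variation, and the last marginal of the target *)

Section FinalEstimates.
Context {R : realType}.

Lemma eventually_ge (B : R) : exists N0 : nat, forall N, (N0 <= N)%N -> B <= N%:R.
Proof.
exists (Num.truncn `|B|).+1 => N NB; apply: le_trans (ler_norm B) _.
have /andP[_ /ltW tB] := truncn_itv (normr_ge0 B).
by apply: (le_trans tB); rewrite ler_nat.
Qed.

(** The exponential is the fourth power of e^(-aN/4): three factors beat the cube, the fourth beats
    the constant [C]. *)
Lemma eventually_decay (C a : R) : 0 < C -> 0 < a ->
  exists N0 : nat, forall N, (N0 <= N)%N ->
    C * N.+1%:R ^+ 3 * expR (- (a * N%:R)) <= 4^-1.
Proof.
move=> C0 a0; pose k := Num.min 1 (a / 4).
have k0 : 0 < k by rewrite lt_min ltr01 divr_gt0.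
have [N0 HN] := eventually_ge (16 * C / k ^+ 3 / a).
exists N0 => N /HN; rewrite ler_pdivrMr // ler_pdivrMr ?exprn_gt0 // => NC.
pose e := expR (a / 4 * N%:R).
have e1 : 1 + a / 4 * N%:R <= e by apply: expR_ge1Dx.
have e0 : 0 < e by apply: expR_gt0.
have kN : k * N.+1%:R <= e.
  apply: le_trans e1; rewrite -natr1 mulrDr mulr1 addrC lerD ?ge_min ?lexx //.
  by rewrite ler_wpM2r // ge_min lexx orbT.
have k3 : k ^+ 3 * N.+1%:R ^+ 3 <= e ^+ 3.
  by rewrite -exprMn lerXn2r ?nnegrE ?mulr_ge0 ?(ltW e0) ?(ltW k0).
have eE : expR (- (a * N%:R)) = (e ^+ 4)^-1.
  by rewrite expRN /e -expRM_natl; congr (_^-1); congr expR; field.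
rewrite eE ler_pdivrMr ?exprn_gt0 //.
rewrite -(ler_pM2l (exprn_gt0 3 k0)).
have h1 := ler_wpM2l (ltW C0) k3.
have h2 : C <= k ^+ 3 / 4 * e.
  have : k ^+ 3 / 4 * (1 + a / 4 * N%:R) <= k ^+ 3 / 4 * e.
    by rewrite ler_wpM2l // divr_ge0 // exprn_ge0 // ltW.
  have : 0 <= k ^+ 3 by rewrite exprn_ge0 // ltW.
  lra.
have h3 := ler_wpM2r (ltW (exprn_gt0 3 e0)) h2.
lra.
Qed.

Lemma dTV_ge (T : finType) (mu nu : T -> R) (A : {set T}) :
  \sum_(x in A) mu x - \sum_(x in A) nu x <= dTV mu nu.
Proof.
apply: le_trans (ler_norm _) _; rewrite /dTV.
exact: (le_bigmax _ (fun A : {set T} => `|\sum_(x in A) mu x - \sum_(x in A) nu x|)).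
Qed.

Lemma EEStarget_last N M (b : nat -> R) (F : Omega N -> R) :
  \sum_(x : EESstate N M.+1) EEStarget N M.+1 b x * F (x ord_max) =
    \sum_s gibbs (b M.+1) s * F s.
Proof.
have gibbs1 c : \sum_(s : Omega N) gibbs c s = 1 :> R.
  rewrite -mulr_suml mulfV // gt_eqF // /Z.
  rewrite (bigD1 [ffun=> ord0]) //= ltr_pwDl ?expR_gt0 //.
  by apply: sumr_ge0 => s _; apply: expR_ge0.
pose G (i : 'I_M.+2) s := gibbs (b i) s * (if i == ord_max then F s else 1).
transitivity (\sum_(x : EESstate N M.+1) \prod_i G i (x i)).
  apply: eq_bigr => x _; rewrite big_split /=; congr (_ * _).
  by rewrite -big_mkcond big_pred1_eq.
rewrite -(bigA_distr_bigA G) (bigD1 ord_max) //= [X in _ * X]big1 ?mulr1.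
  by apply: eq_bigr => s _; rewrite /G eqxx.
move=> i /negPf im; rewrite -[RHS](gibbs1 (b i)).
by apply: eq_bigr => s _; rewrite /G im mulr1.
Qed.

End FinalEstimates.

Theorem theorem4p1 (R : realType) (beta d : R) (bs : nat -> nat -> R)
    (beta_gt : 4 * ln 2 < beta) (beta_lt : beta < 3) (d_gt0 : 0 < d)
    (bsP : forall N M : nat, admissible d N M ->
       temperature_ladder beta M (bs N)) :
  exists (c : R) (N0 : nat), 0 < c /\
    forall N M : nat, admissible d N M -> (N0 <= N)%N ->
      ((expR (c * N%:R))%:E <= tmix (EES N M (bs N)) (EEStarget N M (bs N)))%E.
Proof.
have ln2 : 0 < ln 2 :> R by rewrite ln_gt0 // ltr1n.
have beta_gt0 : 0 < beta by lra.
(* Width of an energy band: (N/3)/M with M = d N, the same for all N. *)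
pose w : R := (3 * d)^-1; have w0 : 0 < w by rewrite invr_gt0 mulr_gt0.
have g0 : 0 < gap beta by apply: gap_gt0.
have k0 : 0 < gap_const beta w by apply: gap_const_gt0.
have dc0 : 0 < drift_const beta by apply: drift_const_gt0.
pose r := Num.min (Num.min (gap beta / 56) (w / 8)) (Num.min (1 / 24) (gap_const beta w / 80)).
have r0 : 0 < r.
  by rewrite !lt_min (divr_gt0 g0) // (divr_gt0 w0) // (divr_gt0 k0) // divr_gt0.
have r1 : 56 * r <= gap beta.
  by rewrite mulrC -ler_pdivlMr // !ge_min lexx.
have r2 : 8 * r <= w by rewrite mulrC -ler_pdivlMr // !ge_min lexx !orbT.
have r3 : r <= 1 / 24 by rewrite !ge_min lexx !orbT.
have r4 : 80 * r <= gap_const beta w by rewrite mulrC -ler_pdivlMr // !ge_min lexx !orbT.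
have rr0 : 0 < r ^+ 2 by rewrite exprn_gt0.
(* The escape rate decays like e^(-4cN) up to polynomial factors, and t(t + 1) costs e^(2cN) for t <
   e^(cN); e^(-2cN) is left. *)
pose c := gap beta * r ^+ 2 / 64.
have c0 : 0 < c by rewrite divr_gt0 // mulr_gt0.
(* With z = e^(beta/4) this is 3z/(z^2 + 2), which is below 1 exactly when (z - 1)(z - 2) > 0; here
   beta > 4 log 2 gives z > 2. The Gibbs mass of the trap is at most a constant times q^N. *)
pose q := 3 * expR (beta / 4) / (expR (beta / 2) + 2).
have z2 : 2 < expR (beta / 4).
  by rewrite -[ltLHS]lnK ?posrE // ltr_expR; lra.
have q0 : 0 < q by rewrite divr_gt0 ?mulr_gt0 ?addr_gt0 ?expR_gt0.
have q1 : q < 1.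
  rewrite ltr_pdivrMr ?addr_gt0 ?expR_gt0 // mul1r.
  have -> : expR (beta / 2) = expR (beta / 4) ^+ 2.
    by rewrite expr2 -expRD; congr expR; field.
  by move: (expR _) z2 => z; nra.
have lq : 0 < - ln q by rewrite oppr_gt0 ln_lt0 // q0 q1.
have ec0 : 0 < escape_const beta w by apply: escape_const_gt0 => //; apply: ltW.
have lc0 : 0 < low_const beta by apply: low_const_gt0.
have [N1 HN1] := eventually_ge (drift_const beta * r ^+ 2)^-1.
have [N2 HN2] := eventually_ge ((3 * w + 1) / r ^+ 2).
have [N3 HN3] := eventually_ge (6 / (gap_const beta w * r * d)).
have ec2 : 0 < 2 * escape_const beta w by rewrite mulr_gt0.
have c2 : 0 < 2 * c by rewrite mulr_gt0.
have [N4 HN4] := eventually_decay ec2 c2.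
have [N5 HN5] := eventually_decay lc0 lq.
exists c, (N1 + N2 + N3 + N4 + N5)%N; split=> // N M adm /leq_sum5[NN1 NN2 NN3 NN4 NN5].
have [b0 bM binc] := bsP N M adm; have [N_gt0 _ M_gt0 Md] := adm.
case: M M_gt0 Md b0 bM binc {adm} => // m _ Md b0 bM binc.
set b := bs N in b0 bM binc *.
have Nr0 : 0 < N%:R :> R by rewrite ltr0n.
have b_ge0 k : (k <= m.+1)%N -> 0 <= b k.
  elim: k => [|k IH] km; first by rewrite b0.
  by apply: le_trans (IH (ltnW km)) (ltW (binc _ km)).
have bm0 : 0 <= b m by apply: b_ge0.
have bmle : b m <= beta by rewrite -bM; apply/ltW/binc.
have Mw : m.+1%:R * w = N%:R / 3.
  by rewrite Md /w; field; rewrite gt_eqF.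
have big1 : N%:R^-1 <= drift_const beta * r ^+ 2.
  rewrite -[leRHS]invrK lef_pV2 ?posrE ?invr_gt0 ?mulr_gt0 //.
  exact: HN1.
have big2 : 3 * w + 1 <= r ^+ 2 * N%:R.
  by rewrite [leRHS]mulrC -ler_pdivrMr // HN2.
have big3 : 6 * m.+2%:R^-1 <= gap_const beta w * r.
  rewrite ler_pdivrMr // -[m.+2%:R]natr1 Md.
  have : 6 / (gap_const beta w * r * d) <= N%:R by apply: HN3.
  have krd0 := mulr_gt0 (mulr_gt0 k0 r0) d_gt0; rewrite ler_pdivrMr // => h6.
  have := mulr_gt0 k0 r0; lra.
rewrite /tmix; apply: le_ereal_inf_tmp => _ [t /= tmixt <-]; rewrite lee_fin.
rewrite leNgt; apply/negP => tc.
have [x0 hx0] := trapped (ltW beta_gt0) beta_lt w0 r0 r1 r2 r3 r4 N_gt0 Mw bM bm0 bmle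
  big1 big2 big3 t.
set J := last_band _ _ _ in hx0.
set ins := inside _ J in hx0.
(* Only the last coordinate matters; the others may start anywhere. *)
pose x : EESstate N m.+1 := [ffun=> x0].
pose A := [set y : EESstate N m.+1 | (@bidx R N m.+1 (y ord_max) <= J)%N].
have massE : \sum_(y in A) kpow (EES N m.+1 b) t x y =
    kact (kpow (EES N m.+1 b) t) (at_last ins) x.
  rewrite big_mkcond; apply: eq_bigr => y _; rewrite inE /at_last /ins /inside.
  by case: ifP; rewrite ?mulr1 ?mulr0.
have iterE : kact (kpow (EES N m.+1 b) t) (at_last ins) =
    at_last (iter t (chain (@excess R N) (@bidx R N m.+1) (b m.+1 - b m)
      (metropolis (b m.+1)) m.+2%:R^-1) ins).
  rewrite kact_kpow; elim: t {tmixt tc hx0 massE} => [//|t IH].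
  by rewrite !iterS IH (kact_EES _ N_gt0 w0 Mw).
have stay : 3 / 4 <= \sum_(y in A) kpow (EES N m.+1 b) t x y.
  rewrite massE iterE /at_last ffunE; apply: le_trans hx0.
  suff : escape_rate beta w r N * t%:R * (t%:R + 1) <= 4^-1 by lra.
  apply: le_trans (HN4 N NN4).
  have e1 : 1 <= expR (c * N%:R) by rewrite -expR0 ler_expR mulr_ge0 ?(ltW c0).
  have tt : t%:R * (t%:R + 1) <= expR (c * N%:R) * (2 * expR (c * N%:R)).
    by apply: ler_pM; rewrite ?addr_ge0 //; lra.
  have er : 0 <= escape_rate beta w r N.
    by rewrite mulr_ge0 ?expR_ge0 // mulr_ge0 ?exprn_ge0 // ltW.
  rewrite -mulrA; apply: (le_trans (ler_wpM2l er tt)).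
  rewrite le_eqVlt; apply/orP; left; apply/eqP.
  have -> : expR (- (2 * c * N%:R)) = expR (- (gap beta / 16 * (r ^+ 2 * N%:R))) *
      (expR (c * N%:R) * expR (c * N%:R)).
    by rewrite -!expRD; congr expR; rewrite /c; field.
  rewrite /escape_rate; ring.
have leave : \sum_(y in A) EEStarget N m.+1 b y <= 4^-1.
  have -> : \sum_(y in A) EEStarget N m.+1 b y = \sum_s gibbs (b m.+1) s * ins s.
    rewrite -EEStarget_last big_mkcond; apply: eq_bigr => y _.
    by rewrite inE /ins /inside; case: ifP; rewrite ?mulr1 ?mulr0.
  rewrite bM.
  pose B := expR (- (beta / 12)) * (expR (beta / 2) + 2).
  have B0 : 0 < B by rewrite mulr_gt0 ?expR_gt0 // addr_gt0 ?expR_gt0.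
  have BN : 0 < B ^+ N by rewrite exprn_gt0.
  have ZB := Z_ge N_gt0 (ltW beta_gt0); rewrite -/B in ZB.
  have Z0 : 0 < @Z R N beta by apply: lt_le_trans ZB.
  (* Inside the trap beta H = beta N/6 + beta h, and beta <= (beta + 3)/2, so [partition_inside]
     applies. *)
  have num : \sum_s expR (beta * H s) * ins s <=
      expR (beta / 6) ^+ N * (low_const beta * 3 ^+ N).
    have e6 : 0 <= expR (beta / 6) ^+ N by rewrite exprn_ge0 ?expR_ge0.
    apply: le_trans (ler_wpM2l e6
      (partition_inside (ltW beta_gt0) beta_lt r0 r1 r3 N_gt0 big1)).
    rewrite mulr_sumr [leRHS]big_mkcond; apply: ler_sum => s _; rewrite /ins /inside.
    have [js|_] := leqP (@bidx R N m.+1 s) J; last first.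
      by rewrite mulr0; case: ifP => // _; apply: mulr_ge0 e6 (expR_ge0 _).
    rewrite (excess_inside w0 N_gt0 Mw js) mulr1 -expRM_natl -expRD ler_expR.
    have := excess_ge0 N_gt0 s : 0 <= excess s :> R.
    rewrite /excess; nra.
  have ratio : \sum_s gibbs beta s * ins s <= low_const beta * q ^+ N.
    have -> : \sum_s gibbs beta s * ins s = (\sum_s expR (beta * H s) * ins s) / @Z R N beta.
      by rewrite mulr_suml; apply: eq_bigr => s _; rewrite /gibbs; ring.
    rewrite ler_pdivrMr //; apply: (le_trans num).
    have lq0 : 0 <= low_const beta * q ^+ N by rewrite mulr_ge0 ?exprn_ge0 // ltW.
    apply: le_trans (ler_wpM2l lq0 ZB).
    have qB : q * B = 3 * expR (beta / 6).
      have -> : beta / 6 = beta / 4 - beta / 12 by field.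
      rewrite expRD /q /B; field; rewrite gt_eqF // addr_gt0 ?expR_gt0 //.
    suff -> : low_const beta * q ^+ N * B ^+ N =
        expR (beta / 6) ^+ N * (low_const beta * 3 ^+ N) by [].
    by rewrite -mulrA -exprMn qB exprMn; ring.
  apply: (le_trans ratio); apply: le_trans (HN5 N NN5).
  have -> : expR (- (- ln q * N%:R)) = q ^+ N.
    by rewrite mulNr opprK mulrC expRM_natl lnK.
  rewrite -mulrA ler_pM2l // ler_peMl ?exprn_ge0 ?(ltW q0) //.
  by rewrite exprn_ege1 // ler1n.
have dx : dTV (kpow (EES N m.+1 b) t x) (EEStarget N m.+1 b) <= 4^-1.
  apply: le_trans tmixt.
  exact: (le_bigmax _ (fun x => dTV (kpow (EES N m.+1 b) t x) (EEStarget N m.+1 b))).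
have := dTV_ge (kpow (EES N m.+1 b) t x) (EEStarget N m.+1 b) A; lra.
Qed.
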